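(* Assume the Hardy-Littlewood Conjecture. Let $D=\pm 2^\sigma p_1\cdots p_r(q_1\cdots q_s)^2(l_1\cdots l_t)^3$ be as in the context. (1) If $D\equiv 1\pmod 4$, or $4\parallel D$ and $D/4\equiv 3\pmod 4$, then $$\mathrm{dens}_D(2)=\frac14\left(1+\frac{(-1)^{r+t}}{\tau(p_1\cdots p_rl_1\cdots l_t)}+\frac{2(-1)^{r_1+r_7+s+t_1+t_7}}{\tau(p_1\cdots p_rq_1\cdots q_sl_1\cdots l_t)}\right),$$ $$\mathrm{dens}_D(-2)=\frac14\left(1+\frac{(-1)^{r+t}}{\tau(p_1\cdots p_rl_1\cdots l_t)}-\frac{2(-1)^{r_1+r_7+s+t_1+t_7}}{\tau(p_1\cdots p_rq_1\cdots q_sl_1\cdots l_t)}\right).$$ (2) If $D\equiv 3\pmod 4$, or $4\parallel D$ and $D/4\equiv 1\pmod 4$, then $$\mathrm{dens}_D(2)=\mathrm{dens}_D(-2)=\frac14\left(1+\frac{(-1)^{r+t}}{\tau(p_1\cdots p_rl_1\cdots l_t)}\right).$$ (3) If $2\parallel D$ or $8\parallel D$, then $\mathrm{dens}_D(2)=\mathrm{dens}_D(-2)=\frac14$.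
   Context: $D=\pm 2^\sigma p_1\cdots p_r(q_1\cdots q_s)^2(l_1\cdots l_t)^3$ with $\sigma\in\{0,1,2,3\}$, $r,s,t\ge0$, and the $p_i,q_i,l_i$ pairwise distinct odd primes. $r_i$ is the number of primes among $p_1,\dots,p_r$ congruent to $i$ mod $8$, and $t_i$ the number of primes among $l_1,\dots,l_t$ congruent to $i$ mod $8$. On odd squarefree positive integers, $\tau(n)=\prod_{l\mid n}\tau(l)$ with $\tau(l)=l$ if $l\equiv3\pmod4$, $\tau(l)=l-2$ if $l\equiv1\pmod4$, and $\tau(1)=1$. $2^k\parallel D$ means $2^k\mid D$ and $2^{k+1}\nmid D$. For a nonzero integer $D$, $E_D$ is the elliptic curve $y^2=x^3+Dx$, and for a prime $p\nmid 2D$, $a_p(E_D)=1+p-\#\tilde E_D(\mathbb{F}_p)$. For a nonzero integer $m$ put $Q(m,N)=\{p \text{ prime}: p=m^2+x^2\le N \text{ for some } x\in\mathbb{Z}\}$ and $$\mathrm{dens}_D(2m)=\lim_{N\to\infty}\frac{\#\{p\in Q(m,N): p\nmid 2D,\ a_p(E_D)=2m\}}{\#Q(m,N)}$$ (denoted $a_p(2m)$ in the paper); the claim includes that the limits exist. Hardy-Littlewood Conjecture: for all integers $a,b,c$ with $a>0$, $\gcd(a,b,c)=1$, $a+b$ and $c$ not both even, and $\Delta=b^2-4ac$ not a perfect square, the number $P(n)$ of primes less than $n$ of the form $ax^2+bx+c$ (with $x$ a nonnegative integer) satisfies $P(n)\sim\delta(a,b,c)\frac{\sqrt{n}}{\log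 n}$ as $n\to\infty$, where $$\delta(a,b,c)=\frac{\gcd(2,a+b)}{\sqrt{a}}\prod_{p\mid a,\ p\mid b,\ p>2}\frac{p}{p-1}\ \prod_{p\nmid a,\ p>2}\left(1-\frac{\left(\frac{\Delta}{p}\right)}{p-1}\right),$$ the products being over primes (the second taken in increasing order of $p$) and $\left(\frac{\cdot}{p}\right)$ being the Legendre symbol. *)

(* Defs.v *)
From mathcomp Require Import all_boot all_order all_algebra.
From mathcomp Require Import all_classical all_reals all_analysis.
Import numFieldNormedType.Exports.

Set Implicit Arguments.
Unset Strict Implicit.
Unset Printing Implicit Defensive.
Import Order.TTheory GRing.Theory Num.Theory.
Local Open Scope classical_set_scope.
Local Open Scope ring_scope.

(* Only meant for p an odd prime; 'F_p is the field Z/p for p prime. *)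
Definition legendre (a : int) (p : nat) : int :=
  if (p%:Z %| a)%Z then 0
  else if [exists x : 'F_p, x ^+ 2 == a%:~R] then 1 else -1.

Section HardyLittlewood.
Variable R : realType.
Implicit Types a b c : int.

Definition discr a b c : int := b ^+ 2 - 4 * a * c.

(* Partial products, in increasing order of p, of the infinite product over
   the odd primes p not dividing a. *)
Definition HL_partial_prod a b c (n : nat) : R :=
  \prod_(0 <= p < n | [&& prime p, (2 < p)%N & ~~ (p%:Z %| a)%Z])
    (1 - (legendre (discr a b c) p)%:~R / (p%:R - 1)).

(* For a nonsquare discriminant the partial products converge (conditionally)
   to a positive limit, so limn below is the value of the infinite product.
   The first product ranges over primes dividing a, hence is finite. *)
Definition HL_delta a b c : R :=
  (gcdz 2 (a + b))%:~R / Num.sqrt a%:~R *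
  (\prod_(p <- primes `|a|%N | (2 < p)%N && (p%:Z %| b)%Z)
      (p%:R / (p%:R - 1))) *
  limn (HL_partial_prod a b c).

Definition HL_count a b c (n : nat) : nat :=
  #|[pred p : 'I_n | prime p &&
      `[< exists x : nat, p%:Z = a * x%:Z ^+ 2 + b * x%:Z + c >]]|.

Definition Hardy_Littlewood_conjecture : Prop :=
  forall a b c : int,
    0 < a ->
    gcdz (gcdz a b) c = 1 ->
    ~ ((2 %| a + b)%Z /\ (2 %| c)%Z) ->
    ~ (exists k : int, discr a b c = k ^+ 2) ->
    (fun n : nat => (HL_count a b c n)%:R : R^o) ~_\oo
      (fun n : nat => HL_delta a b c * (Num.sqrt n%:R / ln n%:R)).

End HardyLittlewood.

(* Points of y^2 = x^3 + D x over 'F_p; None is the point at infinity. *)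
Definition on_curve (D : int) (p : nat) (P : option ('F_p * 'F_p)) : bool :=
  if P is Some (x, y) then y ^+ 2 == x ^+ 3 + D%:~R * x else true.

Definition frob_trace (D : int) (p : nat) : int :=
  1 + p%:Z - #|[pred P | @on_curve D p P]|%:Z.

Definition Q (m : int) (N : nat) : pred 'I_N.+1 :=
  [pred p : 'I_N.+1 | prime p &&
    `[< exists x : int, p%:Z = m ^+ 2 + x ^+ 2 >]].

(* The sequence in N whose limit is dens_D(2m), as a function of m. *)
Definition dens_seq (R : realType) (D m : int) (N : nat) : R :=
  #|[pred p : 'I_N.+1 | [&& Q m p, ~~ (p%:Z %| 2 * D)%Z
                          & frob_trace D p == 2 * m]]|%:R
  / #|@Q m N|%:R.

Definition tau_prime (l : nat) : nat :=
  if (l %% 4 == 3)%N then l else (l - 2)%N.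

(* Only meant for n odd and squarefree. *)
Definition tau (n : nat) : nat := (\prod_(l <- primes n) tau_prime l)%N.

Definition prod_seq (s : seq nat) : nat := (\prod_(p <- s) p)%N.

Definition count_mod8 (i : nat) (s : seq nat) : nat :=
  count (fun p => p %% 8 == i)%N s.

(* 2 ^ k exactly divides D. *)
Definition pow2_exact (k : nat) (D : int) : bool :=
  (2 ^+ k %| D)%Z && ~~ (2 ^+ k.+1 %| D)%Z.

(* Main.v *)
Require Import Defs.
From mathcomp Require Import all_boot all_order all_algebra all_field.
From mathcomp Require Import all_classical all_reals all_analysis.
From mathcomp Require Import ring lra zify.
Import numFieldNormedType.Exports.
Set Implicit Arguments.
Unset Strict Implicit.
Unset Printing Implicit Defensive.
Import Order.TTheory GRing.Theory Num.Theory.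
Local Open Scope classical_set_scope.
Local Open Scope ring_scope.

(** Why the theorem holds.  An odd prime p = 1 + x^2 has the form 1 + 4 y^2,
    with x = 2 y playing the role of a square root of -1 modulo p.  Write chi
    for the quartic residue symbol of F_p: chi(a) is a^((p - 1)/4), read as a
    complex number through x |-> i.  The point count on Y^2 = X^3 + D X is a
    Jacobi sum, and

      a_p(E_D) = chi(D)^3 (1 + x i) + chi(D) (1 - x i),

    so a_p = 2 exactly when chi(D) = 1, and a_p = -2 exactly when chi(D) = -1
    (lemma [frob_trace_pm2]).  The value J(chi, chi) = -(1 + x i) behind this
    formula ([jacobi_value]) is pinned down by its norm p, by a congruence
    modulo p and by a parity count.

    Next, chi(D) depends only on x modulo M = 8 * (product of the odd primes
    dividing D).  For an odd prime l put l' = l or -l, whichever is 1 mod 4.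
    Raising the quartic Gauss sum to the power l in characteristic l gives the
    rational case of quartic reciprocity ([quart_recip]): chi(l') is a fixed
    power of the fraction (1 + x i)/(1 - x i), computed in characteristic l.
    Together with chi(-1) = (-1)^y and chi(2) = i^y ([quart2], which itself
    follows from reciprocity applied to the primes dividing 1 + x), this
    evaluates chi(D) ([quart_D]).

    As c runs over the residues modulo l with c^2 + 1 <> 0, the fraction
    (1 + c i)/(1 - c i) runs over a cyclic group of order 4 m with the single
    element -1 removed.  So there are tau(l) = 4 m - 1 such residues, and all
    nontrivial power sums of the local symbol equal 1 or -1 ([sum_local_sym]).
    The Chinese remainder theorem multiplies these sums ([crt_sum]), and
    summing over the four powers of chi counts the residue classes modulo M on
    which chi(D) is 1 or -1 ([sym_countE]): this is where the two correction
    terms with denominators tau come from.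

    Finally, primes 1 + x^2 with x = rho mod M are the prime values of
    M^2 X^2 + 2 M rho X + rho^2 + 1, whose Hardy-Littlewood constant does not
    depend on rho ([class_deltaE]).  Hence they are equidistributed among the
    classes with rho^2 + 1 prime to M, and the density is a ratio of two
    numbers of classes ([density_limit]).  The constant is nonzero by the
    conjecture itself: were it zero, the prime count would vanish eventually,
    while it is monotone and positive somewhere. *)

(** * Gauss and Jacobi sums over a finite field *)

Section MulChar.
Variables (F : finFieldType) (K : fieldType).
Implicit Types (c d : F -> K) (a b t : F).

(** Multiplicative characters are extended by zero, and the value of the trivial
    one at zero is therefore 0 as well. *)
Definition mulchar c := [/\ c 0 = 0, c 1 = 1 & {morph c : a b / a * b}].

Lemma mulcharX c a n : mulchar c -> c (a ^+ n) = c a ^+ n.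
Proof.
by move=> [_ c1 cM]; elim: n => [|n IH]; rewrite ?expr0 // !exprS cM IH.
Qed.

Lemma mulchar_mul c d : mulchar c -> mulchar d -> mulchar (fun a => c a * d a).
Proof.
move=> [c0 c1 cM] [d0 d1 dM]; split; rewrite ?c0 ?mul0r ?c1 ?d1 ?mulr1 //.
by move=> a b; rewrite cM dM mulrACA.
Qed.

Lemma sum_scale (f : F -> K) t : t != 0 -> \sum_a f a = \sum_a f (t * a).
Proof.
by move=> t0; rewrite (reindex (fun a => t * a)) //;
  exists (fun a => t^-1 * a) => a _; rewrite ?mulKf ?mulVKf.
Qed.

Lemma sum_mulchar0 c t : mulchar c -> t != 0 -> c t != 1 -> \sum_a c a = 0.
Proof.
move=> [_ _ cM] t0 ct; set S := \sum_a c a.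
have : c t * S = S.
  by rewrite [RHS](sum_scale _ t0) big_distrr /=; apply: eq_bigr => a _.
move/eqP; rewrite -subr_eq0 -[X in _ - X]mul1r -mulrBl mulf_eq0 subr_eq0.
by rewrite (negbTE ct) => /eqP.
Qed.

Definition jacobi c d : K := \sum_a c a * d (1 - a).

Variable e : F -> K.
Hypotheses (e0 : e 0 = 1) (eD : {morph e : a b / a + b >-> a * b}).
Hypothesis sum_e : \sum_a e a = 0.

Definition gauss c : K := \sum_a c a * e a.

Lemma gauss_twist c t : mulchar c -> t != 0 ->
  c t * (\sum_a c a * e (t * a)) = gauss c.
Proof.
move=> [_ _ cM] t0; rewrite /gauss [RHS](sum_scale _ t0) big_distrr /=.
by apply: eq_bigr => a _; rewrite cM mulrA.
Qed.

(** Collect the double sum according to a + b = s: the inner sum is a Jacobi sum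
    scaled by c(s) d(s), also for s = 0 since the character c d is nontrivial. *)
Lemma gaussM c d : mulchar c -> mulchar d -> \sum_a c a * d a = 0 ->
  gauss c * gauss d = jacobi c d * gauss (fun a => c a * d a).
Proof.
move=> [c0 c1 cM] [d0 d1 dM] cd0.
have inner s : \sum_a c a * d (s - a) = c s * d s * jacobi c d.
  have [->|s0] := eqVneq s 0.
    rewrite c0 !mul0r; transitivity (d (-1) * \sum_a c a * d a).
      rewrite big_distrr; apply: eq_bigr => a _ /=.
      by rewrite add0r -[- a]mulN1r dM mulrCA.
    by rewrite cd0 mulr0.
  rewrite (sum_scale _ s0) /jacobi big_distrr; apply: eq_bigr => a _ /=.
  by rewrite -{2}[s]mulr1 -mulrBr cM dM mulrACA.
transitivity (\sum_s e s * \sum_a c a * d (s - a)).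
  rewrite /gauss big_distrl /=.
  under [RHS]eq_bigr do rewrite big_distrr.
  rewrite [RHS]exchange_big; apply: eq_bigr => a _ /=.
  rewrite big_distrr /= [RHS](reindex (fun b => a + b)) /=; last first.
    by exists (fun b => b - a) => b _ /=; rewrite addrC ?addKr ?subrK.
  apply: eq_bigr => b _; rewrite addrAC subrr add0r eD; ring.
rewrite /gauss big_distrr; apply: eq_bigr => s _ /=; rewrite inner; ring.
Qed.

(** Here d is the inverse of c.  Substituting a = b t makes the sum over b run
    through all values of the additive character at multiples of t + 1, so only
    t = -1 survives. *)
Lemma gauss_inv c d : mulchar c -> mulchar d -> \sum_a c a = 0 ->
  (forall a, a != 0 -> c a * d a = 1) ->
  gauss c * gauss d = c (-1) * #|F|%:R.
Proof.
move=> [c0 c1 cM] [d0 d1 dM] csum cd.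
transitivity (\sum_(b | b != 0) \sum_t c t * e (b * (t + 1))).
  rewrite mulrC {1}/gauss big_distrl /= (bigD1 0) //= d0 !mul0r add0r.
  apply: eq_bigr => b b0; rewrite /gauss (sum_scale _ b0) big_distrr /=.
  apply: eq_bigr => t _; rewrite cM mulrDr mulr1 eD.
  by transitivity (c b * d b * (c t * (e (b * t) * e b))); [ring | rewrite cd ?mul1r].
rewrite exchange_big /=.
transitivity (\sum_t c t * ((t == -1)%:R * #|F|%:R - 1)).
  apply: eq_bigr => t _; rewrite -big_distrr /=; congr (_ * _).
  have <- : \sum_b e (b * (t + 1)) = (t == -1)%:R * #|F|%:R.
    have [->|t1] := eqVneq t (-1).
      rewrite addNr (eq_bigr (fun=> 1)); last by move=> b _; rewrite mulr0.
      by rewrite sumr_const mul1r.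
    rewrite mul0r; transitivity (\sum_b e b) => //.
    rewrite (sum_scale e (t := t + 1)) ?addr_eq0 //.
    by apply: eq_bigr => b _; rewrite mulrC.
  by rewrite [X in _ = X - 1](bigD1 0) //= mul0r e0 addrAC subrr add0r.
under eq_bigr do rewrite mulrBr mulr1.
rewrite big_split /= sumrN csum subr0 (bigD1 (-1)) //= eqxx mul1r.
by rewrite big1 ?addr0 // => t /negbTE->; rewrite mul0r mulr0.
Qed.
End MulChar.

(** * Transport of fourth roots of unity *)

Section Mu4.
Variables (K L : fieldType) (i : K) (j : L).
Hypotheses (two_neq0 : (2 : K) != 0) (i2 : i ^+ 2 = -1) (j2 : j ^+ 2 = -1).

(** The isomorphism from the fourth roots of unity of K to those of L that sends
    i to j; everything else goes to 0, so that composing it with a power map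
    yields characters extended by zero. *)
Definition mu4_map (z : K) : L :=
  if z == 1 then 1 else if z == i then j else
  if z == -1 then -1 else if z == - i then - j else 0.

Lemma i_pow4 n : i ^+ (4 * n) = 1.
Proof. by rewrite exprM (exprM i 2 2) i2 sqrrN !expr1n. Qed.

Lemma i_mod4 n : i ^+ n = i ^+ (n %% 4).
Proof. by rewrite {1}(divn_eq n 4) exprD mulnC i_pow4 mul1r. Qed.
End Mu4.

Section Mu4Map.
Variables (K L : fieldType) (i : K) (j : L).
Hypotheses (two_neq0 : (2 : K) != 0) (i2 : i ^+ 2 = -1) (j2 : j ^+ 2 = -1).
Local Notation f := (mu4_map i j).

Lemma one_neqN1 : (1 : K) != -1.
Proof. by rewrite -subr_eq0 opprK -mulr2n. Qed.

Lemma i_neq0 : i != 0.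
Proof.
apply/eqP => i0; move/eqP: i2; rewrite i0 expr0n /= eq_sym oppr_eq0.
by rewrite oner_eq0.
Qed.

Lemma mu4_distinct : uniq [:: 1; i; -1; -i].
Proof.
have h (z : K) : z ^+ 2 = - 1 -> z != 1 /\ z != -1.
  move=> zz; split; apply/eqP => z1; move: zz; rewrite z1 ?sqrrN expr1n;
  by move/eqP; rewrite (negbTE one_neqN1).
have [a b] := h _ i2.
have [c d] : - i != 1 /\ - i != -1 by apply: h; rewrite sqrrN.
rewrite /= !inE !negb_or one_neqN1 b (eq_sym 1 i) a (eq_sym 1) c (eq_sym (-1)) d /= !andbT.
by rewrite -subr_eq0 opprK -mulr2n -mulr_natl mulf_neq0 // i_neq0.
Qed.

Lemma mu4P z : z ^+ 4 = 1 -> exists2 n, (n < 4)%N & z = i ^+ n.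
Proof.
move=> z4; have : (z - 1) * (z + 1) * ((z - i) * (z + i)) = 0.
  have -> : (z - 1) * (z + 1) * ((z - i) * (z + i)) =
    z ^+ 4 - z ^+ 2 * (i ^+ 2 + 1) + i ^+ 2 by ring.
  by rewrite z4 i2; ring.
move/eqP; rewrite !mulf_eq0 !subr_eq0 !addr_eq0.
case/orP=> /orP[] /eqP ->; [exists 0%N|exists 2|exists 1%N|exists 3] => //.
by rewrite exprSr i2 mulN1r.
Qed.

Lemma mu4_mapX n : f (i ^+ n) = j ^+ n.
Proof.
rewrite (i_mod4 i2) (i_mod4 j2).
have := mu4_distinct; rewrite /= !inE !negb_or (eq_sym 1 i) (eq_sym 1 (-1)).
rewrite (eq_sym 1 (-i)) (eq_sym i (-1)) (eq_sym i (-i)) (eq_sym (-1) (-i)).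
case/and4P=> /and3P[h1 h2 h3] /andP[h4 h5] h6 _.
have: (n %% 4 < 4)%N by rewrite ltn_mod.
rewrite /mu4_map; case: (n %% 4)%N => [|[|[|[|]]]] // _.
- by rewrite expr0 eqxx.
- by rewrite !expr1 (negbTE h1) eqxx.
- by rewrite i2 j2 (negbTE h2) (negbTE h4) eqxx.
- by rewrite !(exprS _ 2) i2 j2 !mulrN1 (negbTE h3) (negbTE h5) (negbTE h6) eqxx.
Qed.

Lemma mu4_map0 : f 0 = 0.
Proof.
have i0 := i_neq0.
rewrite /mu4_map (eq_sym 0 1) oner_eq0 (eq_sym 0 i) (negbTE i0) (eq_sym 0 (-1)).
by rewrite (eq_sym 0 (-i)) !oppr_eq0 oner_eq0 (negbTE i0).
Qed.

Lemma mu4_map_pow4 z : z ^+ 4 = 1 -> f z ^+ 4 = 1.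
Proof.
by move=> /mu4P[n _ ->]; rewrite mu4_mapX -exprM mulnC (i_pow4 j2).
Qed.

Lemma mu4_mapM z w : z ^+ 4 = 1 -> w ^+ 4 = 1 -> f (z * w) = f z * f w.
Proof. by move=> /mu4P[n _ ->] /mu4P[m _ ->]; rewrite -exprD !mu4_mapX exprD. Qed.

Lemma mu4_map_exp z n : z ^+ 4 = 1 -> f (z ^+ n) = f z ^+ n.
Proof. by move=> /mu4P[m _ ->]; rewrite -exprM !mu4_mapX exprM. Qed.

(** This form exhibits the coordinates in the basis 1, j as integers that do not
    involve L. *)
Lemma mu4_mapE z : f z =
  (z == 1)%:R - (z == -1)%:R + ((z == i)%:R - (z == - i)%:R) * j.
Proof.
have := mu4_distinct; rewrite /= !inE !negb_or.
case/and4P=> /and3P[h1 h2 h3] /andP[h4 h5] h6 _.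
rewrite /mu4_map; have [->|z1] := eqVneq z 1.
  by rewrite (negbTE h1) (negbTE h2) (negbTE h3) /=; ring.
have [->|z2] := eqVneq z i; first by rewrite (negbTE h4) (negbTE h5) /=; ring.
have [->|z3] := eqVneq z (-1); first by rewrite (negbTE h6) /=; ring.
by case: (z == - i) => /=; ring.
Qed.
End Mu4Map.

Lemma mu4_map_comp (K L E : fieldType) (i : K) (j : L) (h : E) z :
    (2 : K) != 0 -> (2 : L) != 0 ->
    i ^+ 2 = -1 -> j ^+ 2 = -1 -> h ^+ 2 = -1 -> z ^+ 4 = 1 ->
  mu4_map j h (mu4_map i j z) = mu4_map i h z.
Proof.
by move=> t1 t2 i2 j2 h2 /(mu4P i2)[n _ ->]; rewrite !mu4_mapX.
Qed.

(** * The quartic residue symbol at a prime 1 + 4 y^2 *)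

Section QuarticSymbol.
Variables (p y : nat).
Hypotheses (p_pr : prime p) (pE : p = (4 * y ^ 2).+1).

Definition Fp_i : 'F_p := (2 * y)%:R.
Local Notation X := Fp_i.
Local Notation k := (y ^ 2)%N.

Lemma y_gt0 : (0 < y)%N.
Proof. by move: p_pr; rewrite pE; case: (y). Qed.

Lemma Fp_p0 : p%:R = 0 :> 'F_p.
Proof. exact: pcharf0 (pchar_Fp p_pr). Qed.

Lemma Fp_natr_eq0 n : ((n%:R : 'F_p) == 0) = (p %| n)%N.
Proof. by rewrite (dvdn_pcharf (pchar_Fp p_pr)). Qed.

Lemma Fp_iK : X ^+ 2 = -1.
Proof.
apply/eqP; rewrite -addr_eq0 -natrX -(natrD _ _ 1) Fp_natr_eq0.
by rewrite pE expnMn addn1.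
Qed.

Lemma p_odd : odd p.
Proof. by rewrite pE /= oddM. Qed.

Lemma Fp_two : (2 : 'F_p) != 0.
Proof.
rewrite Fp_natr_eq0 dvdn_prime2 //.
by apply/eqP => p2; have := p_odd; rewrite p2.
Qed.

Lemma Fp_fermat (a : 'F_p) : a != 0 -> (a ^+ k) ^+ 4 = 1.
Proof.
move=> a0; apply: (mulfI a0); rewrite -exprM -exprS mulr1 mulnC.
by have := expf_card a; rewrite (card_Fp p_pr) -pE.
Qed.

(** Otherwise X^(2k) - 1, with 2k = (p - 1)/2, would have p - 1 roots. *)
Lemma Fp_nonsquare : exists2 t : 'F_p, t != 0 & (t ^+ k) ^+ 2 = -1.
Proof.
have k0 : (0 < 2 * k)%N by rewrite muln_gt0 expn_gt0 y_gt0.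
pose s := enum (predC1 (0 : 'F_p)).
have us : uniq s by rewrite enum_uniq.
have ss : size s = (4 * k)%N by rewrite -cardE cardC1 card_Fp // pE.
have [/(max_unity_roots k0)/(_ us)|] := boolP (all (2 * k).-unity_root s).
  by rewrite ss leq_mul2r; case: (k) k0.
case/allPn=> t; rewrite mem_enum inE => t0 /unity_rootP tk.
exists t => //; have /eqP := Fp_fermat t0.
rewrite (exprM _ 2 2) sqrf_eq1 => /orP[/eqP|/eqP //].
by rewrite -exprM mulnC.
Qed.

Section Char.
Variables (K : fieldType) (j : K).
Hypotheses (two_K : (2 : K) != 0) (j2 : j ^+ 2 = -1).

(** The quartic residue symbol at p, with values in an arbitrary field K and
    normalised by the choice of j as the image of 2 y.  Varying K is essential:
    the complex numbers give the norm of the Jacobi sum, F_p a congruence, and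
    characteristic l the reciprocity law. *)
Definition quart (a : 'F_p) : K := mu4_map X j (a ^+ k).

Lemma quart_pow4 a : a != 0 -> quart a ^+ 4 = 1.
Proof. by move=> a0; rewrite mu4_map_pow4 ?Fp_two ?Fp_iK ?Fp_fermat. Qed.

Lemma quart0 : quart 0 = 0.
Proof.
by rewrite /quart expr0n expn_eq0 /= gtn_eqF ?y_gt0 // mu4_map0 ?Fp_iK ?Fp_two.
Qed.

Lemma quart_mulchar : mulchar quart.
Proof.
split; first exact: quart0.
  by rewrite /quart expr1n -(expr0 X) mu4_mapX ?Fp_iK ?Fp_two.
move=> a b; have [->|a0] := eqVneq a 0; first by rewrite !(mul0r, quart0).
have [->|b0] := eqVneq b 0; first by rewrite !(mulr0, quart0).
by rewrite /quart exprMn mu4_mapM ?Fp_iK ?Fp_two ?Fp_fermat.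
Qed.

Lemma quart_sq_sum0 : \sum_a quart a * quart a = 0.
Proof.
have [t t0 tk] := Fp_nonsquare.
apply: (sum_mulchar0 (mulchar_mul quart_mulchar quart_mulchar) t0).
rewrite -expr2 /quart -mu4_map_exp ?Fp_iK ?Fp_two ?Fp_fermat // tk -Fp_iK.
by rewrite mu4_mapX ?Fp_iK ?Fp_two // j2 eq_sym one_neqN1.
Qed.

Lemma quart_sum0 : \sum_a quart a = 0.
Proof.
have [t t0 tk] := Fp_nonsquare.
apply: (sum_mulchar0 quart_mulchar t0); apply/eqP => ct.
have: quart t ^+ 2 = -1.
  rewrite /quart -mu4_map_exp ?Fp_iK ?Fp_two ?Fp_fermat // tk -Fp_iK.
  by rewrite mu4_mapX ?Fp_iK ?Fp_two.
by rewrite ct expr1n => /eqP; rewrite (negbTE (one_neqN1 _)).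
Qed.

Lemma quartN1 : quart (-1) = (-1) ^+ y.
Proof.
rewrite /quart -[X in X ^+ k]Fp_iK -exprM mu4_mapX ?Fp_iK ?Fp_two //.
by rewrite exprM j2 -[LHS]signr_odd oddX signr_odd.
Qed.

(** -4 is the fourth power of 1 + X. *)
Lemma quartN4 : quart (-4%:R) = 1.
Proof.
have -> : - 4%:R = (1 + X) ^+ 4 :> 'F_p.
  transitivity (- 4 + (X ^+ 2 + 1) * (X ^+ 2 + 4 * X + 5)); last by ring.
  by rewrite Fp_iK addNr mul0r addr0.
rewrite (mulcharX _ _ quart_mulchar) quart_pow4 //.
apply/eqP => /eqP; rewrite addrC addr_eq0 => /eqP X1.
have := Fp_iK; rewrite X1 sqrrN expr1n => /eqP.
by rewrite (negbTE (one_neqN1 Fp_two)).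
Qed.
End Char.

End QuarticSymbol.

(** * The Jacobi sum of the quartic symbol *)

(** Points that are not fixed come in pairs; the rank in an enumeration of T
    tells the two members of a pair apart. *)
Lemma odd_card_involution (T : finType) (P : pred T) (s : T -> T) (x0 : T) :
  involutive s -> (forall x, P (s x) = P x) ->
  (forall x, (s x == x) = (x == x0)) -> odd #|P| = P x0.
Proof.
move=> sK Ps fix_s; pose r (x : T) : nat := enum_rank x.
have r_eq x z : (r x == r z) = (x == z).
  by rewrite -(inj_eq enum_rank_inj) -(inj_eq val_inj).
rewrite -sum1_card (bigID (fun x => r x < r (s x))%N) /=.
rewrite [X in (_ + X)%N](bigID (fun x => r x == r (s x))) /=.
rewrite [X in (_ + (_ + X))%N](reindex_inj (inv_inj sK)) /=.
rewrite [X in (_ + (_ + X))%N](eq_bigl (fun x => P x && (r x < r (s x))%N)); last first.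
  move=> x; rewrite [s x \in P]Ps -andbA sK; congr (_ && _).
  by rewrite -leqNgt [RHS]ltn_neqAle andbC eq_sym.
rewrite addnCA addnn oddD odd_double addbF.
rewrite (eq_bigl (fun x => P x0 && (x == x0))); last first.
  move=> x; rewrite r_eq (eq_sym x) fix_s -leqNgt -[x \in P]/(P x).
  have [->|] := eqVneq x x0; rewrite ?andbF //.
  have /eqP-> : s x0 == x0 by rewrite fix_s.
  by rewrite leqnn !andbT.
case: (P x0); last by rewrite big_pred0.
by rewrite big_pred1_eq.
Qed.

(** For n > 0 the sum is invariant under multiplication by t^n for every nonzero
    t, and some t^n differs from 1. *)
Lemma Fp_sum_pow p n : prime p -> (n < p.-1)%N -> \sum_(a : 'F_p) a ^+ n = 0.
Proof.
move=> p_pr; case: n => [|n] np.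
  rewrite (eq_bigr (fun=> 1)) // sumr_const card_Fp // -[1 *+ _]/(_%:R).
  by rewrite Fp_p0.
pose s := enum (predC1 (0 : 'F_p)).
have us : uniq s by rewrite enum_uniq.
have ss : size s = p.-1 by rewrite -cardE cardC1 card_Fp.
have [/(max_unity_roots (ltn0Sn n))/(_ us)|] := boolP (all n.+1.-unity_root s).
  by rewrite ss leqNgt np.
case/allPn=> t; rewrite mem_enum inE => t0 /unity_rootP tn.
apply/eqP; set S := \sum_a _.
have : t ^+ n.+1 * S = S.
  rewrite [RHS](sum_scale _ t0) big_distrr /=.
  by apply: eq_bigr => a _; rewrite exprMn.
move/eqP; rewrite -subr_eq0 -[X in _ - X]mul1r -mulrBl mulf_eq0 subr_eq0.
by case/orP=> // /eqP.
Qed.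
Section GaussSumsFp.
Variables (p y : nat).
Hypotheses (p_pr : prime p) (pE : p = (4 * y ^ 2).+1).
Local Notation k := (y ^ 2)%N.
Variables (K : fieldType) (j z : K).
Hypotheses (two_K : (2 : K) != 0) (j2 : j ^+ 2 = -1).
Hypotheses (zp : z ^+ p = 1) (z1 : z != 1).

Definition Fp_addchar (a : 'F_p) : K := z ^+ a.
Local Notation e := Fp_addchar.
Local Notation chi := (quart y j : 'F_p -> K).
Local Notation rho := (fun a : 'F_p => chi a * chi a).

Lemma Fp_addcharD : {morph e : a b / a + b >-> a * b}.
Proof.
move=> a b; rewrite /e /= -exprD -[RHS](expr_mod _ zp).
by congr (_ ^+ (_ %% _)); rewrite Fp_cast.
Qed.

Lemma Fp_addchar0 : e 0 = 1. Proof. by []. Qed.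

Lemma Fp_addcharMn (a : 'F_p) n : e (a *+ n) = e a ^+ n.
Proof.
by elim: n => [|n IH]; rewrite ?mulr0n // mulrS Fp_addcharD IH exprS.
Qed.

Lemma sum_Fp_addchar : \sum_a e a = 0.
Proof.
have : z * (\sum_a e a) = \sum_a e a.
  rewrite [RHS](reindex_inj (addrI (1 : 'F_p))) big_distrr /=.
  by apply: eq_bigr => a _; rewrite Fp_addcharD.
move/eqP; rewrite -subr_eq0 -[X in _ - X]mul1r -mulrBl mulf_eq0 subr_eq0.
by rewrite (negbTE z1) => /eqP.
Qed.

Let chiM := quart_mulchar p_pr pE j2.
Let rhoM := mulchar_mul chiM chiM.

Lemma quart_gaussM :
  gauss e chi * gauss e chi = jacobi chi chi * gauss e rho.
Proof.
by apply: (gaussM Fp_addcharD) => //; exact: quart_sq_sum0.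
Qed.

(** The quadratic Gauss sum: rho(-1) = 1 because p = 1 mod 4. *)
Lemma rho_gauss_sq : gauss e rho * gauss e rho = p%:R.
Proof.
rewrite (gauss_inv Fp_addchar0 Fp_addcharD sum_Fp_addchar rhoM rhoM).
- by rewrite card_Fp // quartN1 // -expr2 -exprM mulnC exprM sqrrN !expr1n mul1r.
- exact: quart_sq_sum0.
- by move=> a a0; rewrite -(quart_pow4 p_pr pE j2 a0); ring.
Qed.

Lemma quart_oppr (a : 'F_p) : a != 0 -> quart y j a * quart y (- j) a = 1 :> K.
Proof.
move=> a0; have [n _ ak] := mu4P (Fp_iK p_pr pE) (Fp_fermat p_pr pE a0).
rewrite /quart ak !mu4_mapX ?(Fp_iK p_pr pE) ?(Fp_two p_pr pE) ?sqrrN //.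
by rewrite -exprMn mulrN -expr2 j2 opprK expr1n.
Qed.

Lemma quart_gauss_oppr :
  gauss e chi * gauss e (quart y (- j) : 'F_p -> K) = (-1) ^+ y * p%:R.
Proof.
rewrite (gauss_inv Fp_addchar0 Fp_addcharD sum_Fp_addchar chiM).
- by rewrite card_Fp // quartN1.
- by apply: quart_mulchar => //; rewrite sqrrN.
- exact: quart_sum0.
- exact: quart_oppr.
Qed.
End GaussSumsFp.

Section JacobiSum.
Variables (p y : nat).
Hypotheses (p_pr : prime p) (pE : p = (4 * y ^ 2).+1).
Local Notation k := (y ^ 2)%N.
Local Notation X := (Fp_i p y).
(** J(chi, chi) collects the values of u; A and B are its coordinates in the
    basis 1, j, whatever the target field. *)
Let u (a : 'F_p) := (a * (1 - a)) ^+ k.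
Let N (v : 'F_p) := #|[pred a | u a == v]|.
Let A : int := (N 1)%:Z - (N (-1))%:Z.
Let B : int := (N X)%:Z - (N (- X))%:Z.

Lemma jacobi_coords (K : fieldType) (j : K) : (2 : K) != 0 -> j ^+ 2 = -1 ->
  @jacobi 'F_p K (quart y j) (quart y j) = A%:~R + B%:~R * j.
Proof.
move=> two_K j2; have [_ _ qM] := quart_mulchar p_pr pE j2.
have NE v : (N v)%:R = \sum_(a : 'F_p) (u a == v)%:R :> K.
  rewrite /N -sum1_card natr_sum big_mkcond.
  by apply: eq_bigr => a _; rewrite inE; case: (u a == v).
rewrite /A /B !intrB -!pmulrn !NE -!sumrB big_distrl -big_split /=.
apply: eq_bigr => a _; rewrite -qM /quart -/(u a).
by rewrite mu4_mapE ?(Fp_iK p_pr pE) ?(Fp_two p_pr pE).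
Qed.

(** J(chi) J(chi^-1) = p follows over the complex numbers from the product
    formulas for Gauss sums, since the quadratic Gauss sum squares to p. *)
Lemma jacobi_norm : A ^+ 2 + B ^+ 2 = p%:Z.
Proof.
have [z zP] := C_prim_root_exists (prime_gt0 p_pr).
have zp := prim_expr_order zP.
have z1 : z != 1.
  by rewrite -[z]expr1 -(prim_order_dvd zP) dvdn1 neq_ltn prime_gt1 ?orbT.
have two_C : (2 : algC) != 0 by rewrite pnatr_eq0.
have j2 : 'i ^+ 2 = -1 :> algC by rewrite sqrCi.
have j2' : (- 'i) ^+ 2 = -1 :> algC by rewrite sqrrN.
have p0 : p%:R != 0 :> algC by rewrite pnatr_eq0 -lt0n prime_gt0.
have : (-1) ^+ y * p%:R * ((-1) ^+ y * p%:R) = p%:R * p%:R :> algC.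
  by rewrite mulrACA -expr2 sqrr_sign mul1r.
rewrite -{1 2}(quart_gauss_oppr p_pr pE two_C j2 zp z1) mulrACA.
rewrite !quart_gaussM // mulrACA.
rewrite -[X in _ * (_ * X)](_ : gauss (Fp_addchar z)
   (fun a : 'F_p => quart y 'i a * quart y 'i a) = _); last first.
  apply: eq_bigr => a _; congr (_ * _).
  have [->|a0] := eqVneq a 0; first by rewrite !quart0 // mul0r.
  have h1 := quart_oppr p_pr pE j2 a0.
  have h2 := quart_pow4 p_pr pE j2 a0.
  have c0 : quart y 'i a != 0 :> algC.
    by apply/eqP => c0; move: h1; rewrite c0 mul0r => /eqP; rewrite eq_sym oner_eq0.
  apply: (mulfI c0); apply: (mulfI c0).
  transitivity (quart y 'i a ^+ 4 : algC); first ring.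
  by rewrite h2 mulrA mulrACA h1 mulr1.
rewrite rho_gauss_sq // => /(mulIf p0).
rewrite !jacobi_coords // => AB; apply/eqP; rewrite -(eqr_int algC) -pmulrn.
rewrite -AB rmorphD !rmorphXn /=; apply/eqP.
transitivity ((A%:~R ^+ 2 : algC) - B%:~R ^+ 2 * 'i ^+ 2); last by ring.
by rewrite j2; ring.
Qed.

(** In F_p itself the symbol is a |-> a^k, and a^k (1 - a)^k has degree 2k < p -
    1, so its sum over F_p vanishes. *)
Lemma jacobi_cong : A%:~R + B%:~R * X = 0 :> 'F_p.
Proof.
rewrite -jacobi_coords ?(Fp_iK p_pr pE) ?(Fp_two p_pr pE) //.
have idX a : quart y X a = a ^+ k :> 'F_p.
  have [->|a0] := eqVneq a 0.
    rewrite quart0 // ?(Fp_iK p_pr pE) ?(Fp_two p_pr pE) //.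
    by rewrite expr0n expn_eq0 /= gtn_eqF // (y_gt0 p_pr).
  have [n _ ak] := mu4P (Fp_iK p_pr pE) (Fp_fermat p_pr pE a0).
  by rewrite /quart ak mu4_mapX ?(Fp_iK p_pr pE) ?(Fp_two p_pr pE).
rewrite /jacobi; under eq_bigr do rewrite !idX exprBn big_distrr /=.
rewrite exchange_big big1 // => m _ /=.
have mk : (m <= k)%N by rewrite -ltnS.
under eq_bigr do rewrite mulrC expr1n mulr1 mulrnAl.
rewrite (eq_bigr (fun a : 'F_p => (-1) ^+ m *+ 'C(k, m) * a ^+ (k + m))); last first.
  by move=> a _; rewrite exprD; ring.
have y0 := y_gt0 p_pr pE; rewrite -big_distrr /= Fp_sum_pow ?mulr0 //.
by rewrite pE /=; nia.
Qed.

Lemma half_refl (a : 'F_p) : (1 - a == a) = (a == 2^-1).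
Proof.
have t0 := Fp_two p_pr pE.
rewrite -[RHS](inj_eq (mulfI t0)) mulfV // mulr_natl mulr2n eq_sym.
by rewrite [RHS]eq_sym -[in RHS]subr_eq [RHS]eq_sym.
Qed.

Lemma jacobi_arg_half : u (2^-1) = (-1) ^+ y.
Proof.
have t0 := Fp_two p_pr pE.
rewrite /u; have -> : 1 - 2^-1 = 2^-1 :> 'F_p by apply/eqP; rewrite half_refl.
have h4 : (- 4 : 'F_p) ^+ k = 1.
  have := quartN4 p_pr pE (Fp_iK p_pr pE); rewrite /quart.
  have n40 : - 4 != 0 :> 'F_p by rewrite oppr_eq0 -[4]/((2 * 2)%:R) natrM mulf_neq0.
  have [n _ ->] := mu4P (Fp_iK p_pr pE) (Fp_fermat p_pr pE n40).
  by rewrite mu4_mapX ?(Fp_iK p_pr pE) ?(Fp_two p_pr pE).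
have -> : 2^-1 * 2^-1 = (- 1) * (- 4)^-1 :> 'F_p.
  by rewrite -invfM invrN mulN1r opprK; congr (_^-1); rewrite -natrM.
rewrite exprMn exprVn h4 invr1 mulr1.
by rewrite -[LHS]signr_odd oddX signr_odd.
Qed.

(** The map a |-> 1 - a preserves u and fixes only 1/2, where u takes the value
    (-1)^y. *)
Lemma odd_N v : odd (N v) = (v == (-1) ^+ y).
Proof.
rewrite /N (@odd_card_involution _ _ (fun a => 1 - a) (2^-1)).
- by rewrite /= jacobi_arg_half eq_sym.
- by move=> a; rewrite subKr.
- by move=> a; rewrite /= /u subKr mulrC.
- exact: half_refl.
Qed.

Lemma N_total : (N 1%R + N (-1)%R + (N X + N (- X)%R) + 2 = p)%N.
Proof.
have NE v : N v = (\sum_(a : 'F_p) (u a == v))%N.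
  rewrite /N -sum1_card big_mkcond.
  by apply: eq_bigr => a _; rewrite inE; case: (u a == v).
have one b : (\sum_(a : 'F_p) (a == b) = 1)%N.
  by rewrite (bigD1 b) //= eqxx big1 // => a /negbTE->.
rewrite !NE -[2%N]/(1 + 1)%N -{1}(one 0) -(one 1) -!big_split /=.
rewrite (eq_bigr (fun=> 1%N)) ?sum1_card ?card_Fp // => a _.
have y0 := y_gt0 p_pr pE.
have u0 : (u a == 0) = (a == 0) || (a == 1).
  rewrite /u expf_eq0 expn_gt0 y0 /= mulf_eq0 subr_eq0 [1 == a]eq_sym.
  by [].
have dist := mu4_distinct (Fp_two p_pr pE) (Fp_iK p_pr pE).
move: dist; rewrite /= !inE !negb_or.
case/and4P=> /and3P[h1 h2 h3] /andP[h4 h5] h6 _.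
have [a0|a0] := eqVneq (u a) 0.
  have X0 := i_neq0 (Fp_iK p_pr pE).
  rewrite a0 ![0 == _]eq_sym !oppr_eq0 oner_eq0 (negbTE X0) !add0n.
  move: u0; rewrite a0 eqxx => /esym/orP[]/eqP->.
    by rewrite eqxx eq_sym oner_eq0.
  by rewrite eqxx oner_eq0.
move: u0; rewrite (negbTE a0) => /esym/negbT; rewrite negb_or => /andP[na0 na1].
rewrite (negbTE na0) (negbTE na1) !addn0.
have base0 : a * (1 - a) != 0 by rewrite mulf_neq0 // subr_eq0 eq_sym.
have [n n4] := mu4P (Fp_iK p_pr pE) (Fp_fermat p_pr pE base0).
rewrite -/(u a) => ->; case: n n4 => [|[|[|[|]]]] // _.
- by rewrite expr0 eqxx (negbTE h1) (negbTE h2) (negbTE h3).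
- by rewrite expr1 eqxx eq_sym (negbTE h1) (negbTE h4) (negbTE h5).
- rewrite Fp_iK // eqxx (negbTE h6) eq_sym (negbTE h2).
  by rewrite eq_sym (negbTE h4).
- rewrite exprSr Fp_iK // mulN1r eqxx eq_sym (negbTE h3) eq_sym (negbTE h6).
  by rewrite eq_sym (negbTE h5).
Qed.

(** From A^2 + B^2 = p = 1 + (2 y)^2 and A + 2 y B = 0 mod p, uniqueness of the
    representation of p as a sum of two squares leaves (A, B) = (1, 2 y) or (-1,
    -2 y); the parities of the four value counts determine A + B mod 4 and
    exclude the first. *)
Lemma jacobi_coords_value : A = -1 /\ B = - (2 * y)%:Z.
Proof.
have [c cP] : exists c : int, A + B * (2 * y)%:Z = c * p%:Z.
  apply/dvdzP. rewrite (dvdz_pcharf (pchar_Fp p_pr)) rmorphD rmorphM /=.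
  by rewrite -[(2 * y)%:~R]pmulrn jacobi_cong.
have Xn1 : (X == (-1) ^+ y) = false /\ (- X == (-1) ^+ y) = false.
  have := mu4_distinct (Fp_two p_pr pE) (Fp_iK p_pr pE).
  rewrite -signr_odd /= !inE !negb_or.
  case/and4P=> /and3P[h1 h2 h3] /andP[h4 h5] h6 _.
  by case: (odd y); rewrite ?expr1 ?expr0; split; apply/negbTE => //; rewrite eq_sym.
have := odd_N X; rewrite Xn1.1 => o1.
have := odd_N (- X); rewrite Xn1.2 => o2.
have o3 : odd (N (-1)) = odd y.
  rewrite odd_N -signr_odd; case: (odd y); rewrite ?expr1 ?expr0 ?eqxx //.
  by rewrite eq_sym (negbTE (one_neqN1 (Fp_two p_pr pE))).
have tot := N_total; have nrm := jacobi_norm.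
have BE : B = 2 * ((N X)./2%:Z - (N (-X))./2%:Z).
  have e1 := odd_double_half (N X); have e2 := odd_double_half (N (- X)).
  rewrite o1 in e1; rewrite o2 in e2; rewrite /B -{1}e1 -{1}e2 !add0n -!mul2n; lia.
have [d dP] : exists d : int, A + B = p%:Z - 2 - 2 * (odd y)%:Z + 4 * d.
  exists (- (N (-1))./2%:Z - (N (- X))./2%:Z).
  have e1 := odd_double_half (N (-1)); have e2 := odd_double_half (N (- X)).
  rewrite o3 in e1; rewrite o2 in e2; rewrite -mul2n in e1; rewrite -mul2n add0n in e2.
  rewrite /A /B; lia.
have pZ : p%:Z = 4 * (y ^ 2)%N%:Z + 1 by rewrite pE; lia.
(* The two-square identity bounds A + 2 y B, a multiple of p, by p in
   absolute value. *)
have key : (A + B * (2 * y)%:Z) ^+ 2 + (B - A * (2 * y)%:Z) ^+ 2 = p%:Z ^+ 2.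
  transitivity ((A ^+ 2 + B ^+ 2) * (1 + (2 * y)%:Z ^+ 2)); first by ring.
  rewrite nrm [RHS]expr2; congr (_ * _); rewrite pZ PoszM.
  by rewrite -[(y ^ 2)%N%:Z]/((y ^+ 2)%:Z) rmorphXn /=; ring.
rewrite cP in key.
have p0 : 0 < p%:Z by rewrite ltz_nat prime_gt0.
have c1 : c ^+ 2 <= 1.
  rewrite -(ler_pM2r (exprn_gt0 2 p0)) mul1r -exprMn -key lerDl sqr_ge0 //.
have [c0|c1'] : c = 0 \/ c ^+ 2 = 1.
  have : `|c| <= 1 by rewrite -(@expr_le1 _ 2) // -normrX ger0_norm ?sqr_ge0.
  rewrite ler_norml; case/andP=> cl cu.
  have [->|[->|->]] : c = 0 \/ c = 1 \/ c = -1 by lia.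
  - by left.
  - by right.
  - by right.
  exfalso; move: cP; rewrite c0 mul0r => /eqP; rewrite addr_eq0 => /eqP AE.
  move: BE; set h := (X in 2 * X) => BE.
  have : 4 * (h ^+ 2 * (2 * y)%:Z ^+ 2 + h ^+ 2) = p%:Z.
    by rewrite -nrm AE BE; ring.
  rewrite pZ; move: (_ + _ : int) (y ^ 2)%N; clear; lia.
move: key; rewrite exprMn c1' mul1r => /eqP.
rewrite -subr_eq0 addrAC subrr add0r sqrf_eq0 subr_eq0 => /eqP BA.
have A1 : A ^+ 2 = 1.
  apply: (mulIf (lt0r_neq0 p0)); rewrite mul1r -[RHS]nrm BA pZ PoszM.
  by rewrite -[(y ^ 2)%N%:Z]/((y ^+ 2)%:Z) rmorphXn /=; ring.
move/eqP: A1; rewrite sqrf_eq1 => /orP[]/eqP A1; last first.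
  by rewrite BA A1; split=> //; ring.
exfalso; move: dP; rewrite BA A1 pZ; have := odd_double_half y.
rewrite -mul2n; move: (y ^ 2)%N (odd y) (y./2); clear; lia.
Qed.

Lemma jacobi_value (K : fieldType) (j : K) : (2 : K) != 0 -> j ^+ 2 = -1 ->
  @jacobi 'F_p K (quart y j) (quart y j) = - (1 + (2 * y)%:R * j).
Proof.
move=> two_K j2; rewrite jacobi_coords //; have [-> ->] := jacobi_coords_value.
by rewrite !intrN -pmulrn; ring.
Qed.
End JacobiSum.

(** * The trace of Frobenius as a quartic symbol *)

Section FrobTrace.
#[local] Opaque quart.
Variables (p y : nat).
Hypotheses (p_pr : prime p) (pE : p = (4 * y ^ 2).+1).
Variables (K : numFieldType) (j : K).
Hypothesis j2 : j ^+ 2 = -1.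
Local Notation chi := (quart y j : 'F_p -> K).
Local Notation rho := (fun a : 'F_p => chi a ^+ 2).

Let two_K : (2 : K) != 0. Proof. by rewrite pnatr_eq0. Qed.
Let Nj2 : (- j) ^+ 2 = -1. Proof. by rewrite sqrrN j2. Qed.

Definition sqrt_count (b : 'F_p) : nat := \sum_(v : 'F_p) (v ^+ 2 == b).
Local Arguments sqrt_count _%_R.

Lemma sum_sqr (f : 'F_p -> K) :
  \sum_a f (a ^+ 2) = \sum_b (sqrt_count b)%:R * f b.
Proof.
under [RHS]eq_bigr do rewrite natr_sum big_distrl /=.
rewrite exchange_big; apply: eq_bigr => a _ /=.
rewrite (bigD1 (a ^+ 2)) //= eqxx mul1r big1 ?addr0 // => b.
by rewrite eq_sym => /negbTE->; rewrite mul0r.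
Qed.

Let sum_add (f g : 'F_p -> K) : \sum_a (f a + g a) = \sum_a f a + \sum_a g a.
Proof. exact: big_split. Qed.

Lemma sum_pred1 (b : 'F_p) : (\sum_(v : 'F_p) (v == b) = 1)%N.
Proof. by rewrite (bigD1 b) //= eqxx big1 // => a /negbTE->. Qed.

(** The difference of the two sides is nonnegative at every b, and both sides
    sum to p. *)
Lemma sqrt_countE b : (sqrt_count b)%:R = 1 + rho b :> K.
Proof.
pose d b := 1 + rho b - (sqrt_count b)%:R : K.
have chiM := quart_mulchar p_pr pE j2.
have d_ge0 c : true -> 0 <= d c.
  move=> _; rewrite /d; have [->|c0] := eqVneq c 0.
    rewrite quart0 // expr0n addr0 subr_ge0 /sqrt_count lern1.
    rewrite -[leqRHS](sum_pred1 0) leq_sum // => v _; rewrite sqrf_eq0.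
    by case: (v == 0).
  have [/existsP[v /eqP vc]|] := boolP [exists v : 'F_p, v ^+ 2 == c].
    have v0 : v != 0 by apply: contraNneq c0 => v0; rewrite -vc v0 expr0n.
    rewrite -vc mulcharX // -exprM (quart_pow4 p_pr pE j2 v0) subr_ge0.
    have -> : 1 + 1 = (\sum_(w : 'F_p) ((w == v) + (w == - v)))%:R%N :> K.
      by rewrite big_split /= !sum_pred1.
    by rewrite ler_nat leq_sum // => w _; rewrite eqf_sqr;
      case: (w == v); case: (w == - v).
  rewrite negb_exists => /forallP nc.
  rewrite /sqrt_count big1 => [|v _]; last by rewrite (negbTE (nc v)).
  rewrite subr0; have /eqP := quart_pow4 p_pr pE j2 c0.
  rewrite (exprM _ 2 2) sqrf_eq1 => /orP[] /eqP->; last by rewrite subrr.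
  by rewrite addr_ge0 ?ler01.
have d_sum : \sum_c d c = 0.
  rewrite /d sumrB big_split /=.
  under [X in _ + X - _]eq_bigr do rewrite expr2.
  rewrite quart_sq_sum0 // addr0 sumr_const card_Fp //.
  have := sum_sqr (fun=> 1).
  under [in RHS]eq_bigr do rewrite mulr1; move=> <-.
  by rewrite sumr_const card_Fp // subrr.
have /eqP := psumr_eq0P d_ge0 d_sum (erefl true : (xpredT b)).
by rewrite subr_eq0 => /eqP<-.
Qed.

(** Solving a (1 - a) = c amounts to extracting a square root of 1 - 4 c, so
    J(chi, chi) can be rewritten as a sum of chi against rho. *)
Lemma jacobi_shift (h : K) : h ^+ 2 = -1 ->
  (forall a : 'F_p, (quart y h a : K) ^+ 2 = rho a) ->
  quart y h (4 : 'F_p) * jacobi (quart y h : 'F_p -> K) (quart y h) =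
  \sum_(v : 'F_p) quart y h v * rho (1 - v).
Proof.
move=> h2 hrho; have [q0 q1 qM] := quart_mulchar p_pr pE h2.
have two0 := Fp_two p_pr pE.
have four0 : 4 != 0 :> 'F_p by rewrite -[4]/((2 * 2)%:R) natrM mulf_neq0.
rewrite (sum_scale _ four0) /jacobi.
have -> : \sum_(a : 'F_p) quart y h a * quart y h (1 - a) =
    \sum_(c : 'F_p) (sqrt_count (1 - 4 * c))%:R * (quart y h c : K).
  under [RHS]eq_bigr do rewrite natr_sum big_distrl /=.
  rewrite exchange_big /= [RHS](reindex (fun a : 'F_p => 1 - 2 * a)) /=; last first.
    exists (fun w => 2^-1 * (1 - w)) => w _; first by rewrite subKr mulKf.
    by rewrite mulVKf // subKr.
  apply: eq_bigr => a _; rewrite (bigD1 (a * (1 - a))) //= -qM.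
  have -> : (1 - 2 * a) ^+ 2 == 1 - 4 * (a * (1 - a)) by apply/eqP; ring.
  rewrite mul1r big1 ?addr0 // => c ca; case: eqP; rewrite ?mul0r // => e.
  case/eqP: ca; apply: (mulfI four0); apply: oppr_inj; apply: (addrI 1).
  by rewrite -e; ring.
under eq_bigr do rewrite sqrt_countE mulrDl mul1r.
rewrite sum_add (quart_sum0 p_pr pE two_K h2) add0r big_distrr.
apply: eq_bigr => a _.
by rewrite qM /= mulrA mulrAC.
Qed.

(** Scale u by -D; the factor chi(-D) chi(4) that comes out equals chi(D),
    because chi(-4) = 1. *)
Lemma quart_shift_sum (h : K) (D : 'F_p) : h ^+ 2 = -1 ->
  (forall a : 'F_p, (quart y h a : K) ^+ 2 = rho a) -> D != 0 ->
  \sum_(u : 'F_p) quart y h u * rho (u + D) =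
  quart y h D ^+ 3 * jacobi (quart y h : 'F_p -> K) (quart y h).
Proof.
move=> h2 hrho D0; have [q0 q1 qM] := quart_mulchar p_pr pE h2.
have [_ _ cM] := quart_mulchar p_pr pE j2.
have ND0 : - D != 0 by rewrite oppr_eq0.
rewrite (sum_scale _ ND0).
transitivity (quart y h (- D) * rho D *
    \sum_(v : 'F_p) quart y h v * rho (1 - v) : K).
  rewrite big_distrr; apply: eq_bigr => v _ /=.
  have -> : - D * v + D = D * (1 - v) by ring.
  rewrite qM cM exprMn -[LHS]mulrA -[RHS]mulrA; congr (_ * _).
  by rewrite mulrCA.
rewrite -(hrho D).
have e : quart y h (- D) * quart y h (4 : 'F_p) = quart y h D :> K.
  transitivity (quart y h D * quart y h (- 4 : 'F_p) : K).
    by rewrite -[LHS]qM -[RHS]qM mulNr mulrN.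
  by rewrite quartN4 // mulr1.
set J := jacobi _ _; rewrite (_ : \sum_v _ = quart y h (4 : 'F_p) * J); last first.
  by rewrite /J jacobi_shift.
by rewrite mulrA [X in X * J]mulrAC e -exprS.
Qed.

Lemma card_curve (D : int) :
  #|[pred P | @on_curve D p P]| =
  (\sum_(x : 'F_p) sqrt_count (x ^+ 3 + D%:~R * x)).+1.
Proof.
rewrite -sum1_card (bigD1 None) //= add1n; congr _.+1.
rewrite (reindex_onto Some (odflt (0, 0))) /=; last by case.
rewrite (eq_bigl (fun P : 'F_p * 'F_p => P.2 ^+ 2 == P.1 ^+ 3 + D%:~R * P.1)); last first.
  by case=> a b; rewrite inE eqxx !andbT.
rewrite big_mkcond /= -(pair_bigA _ (fun a b : 'F_p =>
  if (b ^+ 2 == a ^+ 3 + D%:~R * a)%R then 1 else 0)%N) /=.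
by apply: eq_bigr => a _; apply: eq_bigr => b _; case: eqP.
Qed.

(** Write x^3 + D x as x (x^2 + D), with rho(x) = chi(x^2); summing over squares
    u = x^2 brings in chi(u) and chi(u) rho(u), the symbols attached to j and to
    -j. *)
Lemma frob_traceE (D : int) (c := quart y j (D%:~R : 'F_p) : K) :
  (D%:~R : 'F_p) != 0 ->
  (frob_trace D p)%:~R =
  c ^+ 3 * (1 + (2 * y)%:R * j) + c * (1 - (2 * y)%:R * j) :> K.
Proof.
move=> D0; set d : 'F_p := D%:~R in c D0 *.
have [c0 c1 cM] := quart_mulchar p_pr pE j2.
pose chi' : 'F_p -> K := quart y (- j).
have chi'E a : chi' a = chi a ^+ 3.
  have [->|a0] := eqVneq a 0; first by rewrite /chi' !quart0 // expr0n.
  have h := quart_oppr p_pr pE j2 a0.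
  have ch0 : chi a != 0 by apply: contra_eq_neq h => ->; rewrite mul0r eq_sym oner_eq0.
  by apply: (mulfI ch0); rewrite h -exprS (quart_pow4 p_pr pE j2 a0).
have rho' a : chi' a ^+ 2 = rho a.
  have [->|a0] := eqVneq a 0; first by rewrite /chi' !quart0.
  by rewrite chi'E -exprM (exprD _ 4 2) (quart_pow4 p_pr pE j2 a0) mul1r.
have main : \sum_(x : 'F_p) (sqrt_count (x ^+ 3 + d * x))%:R =
   p%:R + (c ^+ 3 * jacobi chi chi + chi' d ^+ 3 * jacobi chi' chi').
  rewrite -(quart_shift_sum j2) // -(quart_shift_sum Nj2) //.
  under eq_bigr do rewrite sqrt_countE.
  rewrite sum_add; congr (_ + _); first by rewrite sumr_const card_Fp.
  transitivity (\sum_(x : 'F_p) chi (x ^+ 2) * rho (x ^+ 2 + d)).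
    apply: eq_bigr => x _.
    have -> : x ^+ 3 + d * x = x * (x ^+ 2 + d) by rewrite mulrDr -exprS mulrC.
    by rewrite cM exprMn -[chi (x ^+ 2)]/(chi (x * x)) cM -expr2.
  rewrite (sum_sqr (fun u => chi u * rho (u + d))) -[RHS]sum_add.
  apply: eq_bigr => u _; rewrite sqrt_countE -/(chi' u) chi'E mulrDl mul1r.
  by rewrite mulrA -exprSr.
rewrite /frob_trace card_curve intrB intrD -!pmulrn.
set N := (X in _ - X.+1%:R); rewrite -[N.+1]add1n natrD.
have -> : N%:R = \sum_(x : 'F_p) (sqrt_count (x ^+ 3 + d * x))%:R :> K.
  by rewrite /N natr_sum.
rewrite main (jacobi_value p_pr pE two_K j2) (jacobi_value p_pr pE two_K Nj2).
have -> : chi' d ^+ 3 = c.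
  have h4 := quart_pow4 p_pr pE j2 D0.
  transitivity ((c ^+ 4) ^+ 2 * c); last by rewrite h4 expr1n mul1r.
  by rewrite chi'E -!exprM -exprSr.
rewrite mulrN; ring.
Qed.

(** When chi(D) is j or -j the trace is 4 y or -4 y, which is neither 2 nor -2. *)
Lemma frob_trace_pm2 (D : int) (e : bool) : (D%:~R : 'F_p) != 0 ->
  (frob_trace D p == 2 * (-1) ^+ e) =
  (quart y j (D%:~R : 'F_p) == (-1) ^+ e :> K).
Proof.
move=> D0; rewrite -(eqr_int K) frob_traceE //.
have /(mu4P j2)[n n4 ->] := quart_pow4 p_pr pE j2 D0.
rewrite intrM rmorphXn /= rmorphN1 -/(2%:R) -[2%:~R]/(2%:R).
have m4 := mu4_distinct two_K j2.
move: m4; rewrite /= !inE !negb_or.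
case/and4P=> /and3P[h1 h2 h3] /andP[h4 h5] h6 _.
have y2 : (2 * y)%:R != 1 :> K.
  by rewrite -[1]/(1%:R) eqr_nat; apply/eqP => /(congr1 odd); rewrite oddM.
have y2' : (2 * y)%:R != -1 :> K.
  by rewrite eq_sym lt_eqF // (lt_le_trans (y := 0)) ?ler0n // oppr_lt0 ltr01.
have y3 : - (2 * y)%:R != 1 :> K by rewrite eqr_oppLR.
have y3' : - (2 * y)%:R != -1 :> K by rewrite eqr_opp.
have two_inj := inj_eq (mulfI two_K).
case: n n4 => [|[|[|[|]]]] // _.
- rewrite !expr0 expr1n !mul1r (_ : _ + _ = 2 * 1 :> K); last by ring.
  by rewrite two_inj.
- rewrite !expr1 (_ : _ + _ = 2 * (2 * y)%:R :> K); last first.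
    transitivity (j ^+ 3 * (1 + (2 * y)%:R * j) + j - j ^+ 2 * (2 * y)%:R); first by ring.
    by rewrite (exprS _ 2) j2; ring: j2.
  rewrite two_inj; case: e; rewrite ?expr0 ?expr1.
    by rewrite (negbTE y2') (negbTE h4).
  by rewrite (negbTE y2) eq_sym (negbTE h1).
- rewrite j2 (_ : _ + _ = 2 * -1 :> K); last by ring.
  by rewrite two_inj.
- have -> : j ^+ 3 = - j by rewrite exprSr j2 mulN1r.
  rewrite (_ : _ + _ = 2 * - (2 * y)%:R :> K); last by ring: j2.
  rewrite two_inj; case: e; rewrite ?expr0 ?expr1.
    by rewrite (negbTE y3') eq_sym (negbTE h6).
  by rewrite (negbTE y3) eq_sym (negbTE h3).
Qed.
End FrobTrace.

(** * Quartic reciprocity for rational primes *)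

Section LocalSymbol.
Variables (l : nat) (K : fieldType) (j : K).

(** The fraction (1 + c j)/(1 - c j) or its inverse, raised to the power (l -
    1)/4 or (l + 1)/4: the value, in characteristic l, of the quartic symbol
    modulo l at 1 + c j. *)
Definition local_arg (c : nat) : K :=
  if (l %% 4 == 1)%N then ((1 + c%:R * j) / (1 - c%:R * j)) ^+ (l %/ 4)
  else ((1 - c%:R * j) / (1 + c%:R * j)) ^+ (l %/ 4).+1.

Definition lstar : int := if (l %% 4 == 1)%N then l%:Z else - l%:Z.
End LocalSymbol.

Section Reciprocity.
Variables (p y l : nat).
Hypotheses (p_pr : prime p) (pE : p = (4 * y ^ 2).+1).
Hypotheses (l_pr : prime l) (l_odd : odd l) (lp : l != p).
Variables (K : fieldType) (j z : K).
Hypotheses (chK : l \in [pchar K]) (j2 : j ^+ 2 = -1).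
Hypotheses (zp : z ^+ p = 1) (z1 : z != 1).
#[local] Opaque quart.

Let two_K : (2 : K) != 0.
Proof.
rewrite -(dvdn_pcharf chK) dvdn_prime2 //.
by apply: contraTneq l_odd => ->.
Qed.

Let p_K : p%:R != 0 :> K.
Proof. by rewrite -(dvdn_pcharf chK) dvdn_prime2. Qed.

Local Notation chi := (quart y j : 'F_p -> K).
Local Notation g := (gauss (Fp_addchar z) chi).
Local Notation g' := (gauss (Fp_addchar z) (quart y (- j) : 'F_p -> K)).
Local Notation P := (1 + (2 * y)%:R * j).
Local Notation M := (1 - (2 * y)%:R * j).

Let PM : P * M = p%:R.
Proof.
transitivity (1 - ((2 * y) ^ 2)%:R * j ^+ 2 : K); first by rewrite natrX; ring.
by rewrite j2 mulrN1 opprK expnMn addrC natr1 -pE.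
Qed.

Let P0 : P != 0.
Proof. by apply: contraNneq p_K => P0; rewrite -PM P0 mul0r. Qed.
Let M0 : M != 0.
Proof. by apply: contraNneq p_K => M0; rewrite -PM M0 mulr0. Qed.

(** The fourth power of the Gauss sum lies in Z[j]: it is J^2 p with J = -P and
    p = P M. *)
Lemma quart_gauss_pow4 : g ^+ 4 = P ^+ 3 * M.
Proof.
have gg := quart_gaussM p_pr pE two_K j2 zp.
rewrite (jacobi_value p_pr pE two_K j2) in gg.
rewrite (exprM _ 2 2) expr2 [g ^+ 2]expr2 gg mulrACA.
by rewrite (rho_gauss_sq p_pr pE two_K j2 zp z1) -PM; ring.
Qed.

Let g0 : g != 0.
Proof.
apply: contraTneq (mulf_neq0 (expf_neq0 3 P0) M0) => g0.
by rewrite -quart_gauss_pow4 g0 expr0n eqxx.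
Qed.

(** The l-th power map is additive in characteristic l. *)
Lemma gauss_frob (f : 'F_p -> K) :
  (\sum_a f a * Fp_addchar z a) ^+ l =
  \sum_a f a ^+ l * Fp_addchar z (l%:R * a).
Proof.
rewrite -(pFrobenius_autE chK) rmorph_sum; apply: eq_bigr => a _.
by rewrite /= pFrobenius_autE exprMn -(Fp_addcharMn p_pr zp) mulr_natl.
Qed.

Let l_Fp : (l%:R : 'F_p) != 0.
Proof. by rewrite (Fp_natr_eq0 p_pr) dvdn_prime2 // eq_sym. Qed.

Let jl : j ^+ l = (-1) ^+ (l %/ 2) * j.
Proof.
by rewrite {1}(divn_eq l 2) modn2 l_odd exprD mulnC exprM j2.
Qed.

(** As chi^l = chi, the l-th power of the Gauss sum g is g / chi(l); compare
    with the value of g^(l - 1), where P^(l - 1) = 1 because j lies in the prime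
    field. *)
Lemma quart_recip1 : (l %% 4 == 1)%N ->
  quart y j (l%:R : 'F_p) * M ^+ (l %/ 4) = P ^+ (l %/ 4).
Proof.
move=> l4; set m := (l %/ 4)%N.
have lE : l = (4 * m).+1 by rewrite {1}(divn_eq l 4) (eqP l4) mulnC addn1.
have gl : quart y j (l%:R : 'F_p) * g ^+ l = g.
  rewrite gauss_frob.
  rewrite -[RHS](gauss_twist _ (quart_mulchar p_pr pE j2) l_Fp); congr (_ * _).
  apply: eq_bigr => a _; congr (_ * _).
  have [->|a0] := eqVneq a 0; first by rewrite quart0 // expr0n gtn_eqF // prime_gt0.
  by rewrite {1}lE exprS exprM (quart_pow4 p_pr pE j2 a0) expr1n mulr1.
have Pl : P ^+ (4 * m) = 1.
  apply: (mulfI P0); rewrite -exprS -lE mulr1 -(pFrobenius_autE chK) rmorphD rmorphM.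
  rewrite rmorph1 rmorph_nat /= pFrobenius_autE jl.
  have -> : (l %/ 2 = 2 * m)%N by rewrite lE -addn1; move: (m); clear; lia.
  by rewrite exprM sqrrN !expr1n mul1r.
have : quart y j (l%:R : 'F_p) * g ^+ (4 * m) = 1.
  by apply: (mulfI g0); rewrite mulrCA -exprS -lE gl mulr1.
rewrite exprM quart_gauss_pow4 exprMn -exprM mulrCA mulrA => e.
apply: (mulfI (expf_neq0 (3 * m) P0)); rewrite mulrA e.
by rewrite -exprD (_ : 3 * m + m = 4 * m)%N ?Pl // addnC.
Qed.

(** Now chi^l is the inverse of chi, so g^(l + 1) is chi(l) g g' with g g'
    known, and P^l = M because j^l = -j. *)
Lemma quart_recip3 : (l %% 4 == 3)%N ->
  quart y j (- l%:R : 'F_p) * P ^+ (l %/ 4).+1 = M ^+ (l %/ 4).+1.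
Proof.
move=> l4; set m := (l %/ 4).+1.
have lE : l.+1 = (4 * m)%N by rewrite {1}(divn_eq l 4) (eqP l4) /m; clear; lia.
have Nj2 : (- j) ^+ 2 = -1 by rewrite sqrrN.
have gl : quart y (- j) (l%:R : 'F_p) * g ^+ l = g'.
  rewrite gauss_frob.
  rewrite -[RHS](gauss_twist _ (quart_mulchar p_pr pE Nj2) l_Fp); congr (_ * _).
  apply: eq_bigr => a _; congr (_ * _).
  have [->|a0] := eqVneq a 0; first by rewrite !quart0 // expr0n gtn_eqF // prime_gt0.
  have h := quart_oppr p_pr pE j2 a0.
  have ch0 : chi a != 0 by apply: contra_eq_neq h => ->; rewrite mul0r eq_sym oner_eq0.
  by apply: (mulfI ch0); rewrite h -exprS lE exprM (quart_pow4 p_pr pE j2 a0) expr1n.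
have Pl : P ^+ (4 * m) = P * M.
  rewrite -lE exprS; congr (_ * _); rewrite -(pFrobenius_autE chK) rmorphD rmorphM.
  rewrite rmorph1 rmorph_nat /= pFrobenius_autE jl.
  have -> : (l %/ 2 = (2 * (l %/ 4)).+1)%N by move: (eqP l4); clear; lia.
  by rewrite exprS exprM sqrrN !expr1n mulr1 mulN1r mulrN.
have gg := quart_gauss_oppr p_pr pE two_K j2 zp z1.
have : quart y (- j) (l%:R : 'F_p) * g ^+ (4 * m) = (-1) ^+ y * (P * M).
  by rewrite -lE exprS mulrCA gl gg PM.
rewrite exprM quart_gauss_pow4 exprMn -exprM -Pl => e.
have [_ _ cM] := quart_mulchar p_pr pE j2.
rewrite -mulN1r cM (quartN1 p_pr pE j2).
have h := quart_oppr p_pr pE j2 l_Fp.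
set c := quart y j _ in h *; set c' := quart y (- j) _ in h e.
have c'0 : c' != 0 by apply: contra_eq_neq h => ->; rewrite mulr0 eq_sym oner_eq0.
apply: (mulfI c'0); apply: (mulfI (expf_neq0 (3 * m) P0)).
transitivity (c * c' * ((-1) ^+ y * P ^+ (3 * m + m))); first by rewrite exprD; ring.
rewrite h mul1r (_ : 3 * m + m = 4 * m)%N; last by rewrite addnC.
by rewrite -e; ring.
Qed.

Lemma quart_recip : quart y j ((lstar l)%:~R : 'F_p) = local_arg l j (2 * y).
Proof.
rewrite /lstar /local_arg; case: ifP => l4.
  rewrite -pmulrn; apply: (mulIf (expf_neq0 (l %/ 4) M0)).
  by rewrite quart_recip1 // exprMn exprVn mulfVK ?expf_neq0.
rewrite intrN -pmulrn; apply: (mulIf (expf_neq0 (l %/ 4).+1 P0)).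
rewrite quart_recip3 //; last by move: l4 l_odd; clear; lia.
by rewrite exprMn exprVn mulfVK ?expf_neq0.
Qed.
End Reciprocity.

(** * Power sums of the local symbol at an odd prime *)

Lemma closed_prim_root (K : closedFieldType) n : n%:R != 0 :> K ->
  exists z : K, n.-primitive_root z.
Proof.
move=> nK; have n0 : (0 < n)%N by case: n nK => //; rewrite eqxx.
pose q : {poly K} := 'X^n - 1; have [r Dp] := closed_field_poly_normal q.
rewrite (monicP _) ?monicXnsubC // scale1r in Dp.
have rn1: all n.-unity_root r by apply/allP=> z; rewrite -root_prod_XsubC -Dp.
have sz_r: (n < (size r).+1)%N.
  by rewrite -(size_prod_XsubC r id) -Dp size_XnsubC.
have [|z] := hasP (cyclic.has_prim_root n0 rn1 _ sz_r); last by exists z.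
by rewrite -separable_prod_XsubC -Dp separable_Xn_sub_1.
Qed.

Section LocalSums.
Variables (l : nat) (l_pr : prime l) (l_odd : odd l).
Variables (K : closedFieldType) (j : K).
Hypotheses (chK : l \in [pchar K]) (j2 : j ^+ 2 = -1).

Let two_K : (2 : K) != 0.
Proof.
rewrite -(dvdn_pcharf chK) dvdn_prime2 //.
by apply: contraTneq l_odd => ->.
Qed.

(* This m is (l - 1)/4 or (l + 1)/4, and the sign in j0 makes both residues of
   l modulo 4 obey the same formula. *)
Local Notation m := (l.+1 %/ 4)%N.
Let s := (l %% 4 == 1)%N.
Let j0 : K := if s then j else - j.

Let j02 : j0 ^+ 2 = -1.
Proof. by rewrite /j0; case: s; rewrite ?sqrrN. Qed.

Let j0l : j0 ^+ l = if s then j0 else - j0.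
Proof.
rewrite {1}(divn_eq l 2) modn2 l_odd exprD mulnC exprM j02 expr1 -signr_odd.
rewrite (_ : odd (l %/ 2) = ~~ s); last by move: l_odd; rewrite /s; clear; lia.
by case: s; rewrite ?mul1r ?mulN1r.
Qed.

Let lm : (4 * m)%N = if s then l.-1 else l.+1.
Proof. by move: l_odd; rewrite /s; clear; case: ifP; lia. Qed.

Let m_gt0 : (0 < m)%N.
Proof. by move: l_odd (prime_gt1 l_pr); clear; lia. Qed.

Definition mobius (c : nat) : K := (1 + c%:R * j0) / (1 - c%:R * j0).

Lemma local_argE c : local_arg l j c = mobius c ^+ m.
Proof.
rewrite /local_arg /mobius /j0 -/s; case: ifP => sl.
  by congr (_ ^+ _); move: sl l_odd; rewrite /s; clear; lia.
rewrite !mulrN opprK; congr (_ ^+ _).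
by move: sl l_odd; rewrite /s; clear; lia.
Qed.

Lemma mobius_norm (c : nat) :
  (1 + c%:R * j0) * (1 - c%:R * j0) = (c ^ 2 + 1)%:R :> K.
Proof.
transitivity (1 - (c ^ 2)%:R * j0 ^+ 2 : K); first by rewrite natrX; ring.
by rewrite j02 mulrN1 opprK natrD addrC.
Qed.

Lemma mobius_period c : mobius (c %% l) = mobius c.
Proof.
have h : (c %% l)%:R = c%:R :> K.
  by rewrite {2}(divn_eq c l) natrD natrM (pcharf0 chK) mulr0 add0r.
by rewrite /mobius h.
Qed.

Lemma mobius0 c : (l %| c ^ 2 + 1)%N -> mobius c = 0.
Proof.
rewrite (dvdn_pcharf chK) -mobius_norm mulf_eq0 /mobius => /orP[]/eqP->.
  by rewrite mul0r.
by rewrite invr0 mulr0.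
Qed.

Lemma mobius_den c : ~~ (l %| c ^ 2 + 1)%N ->
  1 + c%:R * j0 != 0 /\ 1 - c%:R * j0 != 0.
Proof.
by rewrite (dvdn_pcharf chK) -mobius_norm mulf_eq0 negb_or => /andP.
Qed.

(** Frobenius fixes 1 + c j0 if l = 1 mod 4 and conjugates it if l = 3 mod 4; so
    the fraction lies in F_l^* or in the group of norm one elements of F_(l^2). *)
Lemma mobius_unity c : ~~ (l %| c ^ 2 + 1)%N -> mobius c ^+ (4 * m) = 1.
Proof.
move=> /mobius_den[P0 M0].
have frob (h : K) : (1 + c%:R * h) ^+ l = 1 + c%:R * h ^+ l.
  rewrite -(pFrobenius_autE chK) rmorphD rmorphM rmorph1 rmorph_nat /=.
  by rewrite pFrobenius_autE.
have Pl := frob j0; have Ml := frob (- j0).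
rewrite exprNn -signr_odd l_odd expr1 mulN1r !mulrN in Ml.
rewrite j0l in Pl Ml.
rewrite /mobius expr_div_n lm.
case: s Pl Ml => Pl Ml.
  apply: (mulIf (mulf_neq0 P0 (invr_neq0 M0))); rewrite mul1r.
  by rewrite mulrACA -exprSr prednK ?prime_gt0 // -exprVn -exprSr
    prednK ?prime_gt0 // exprVn Pl Ml.
rewrite mulrN in Pl; rewrite mulrN opprK in Ml.
by rewrite !exprS Pl Ml [X in X / _]mulrC divff ?mulf_neq0.
Qed.

Lemma mobiusN1 c : ~~ (l %| c ^ 2 + 1)%N -> mobius c != -1.
Proof.
move=> /mobius_den[P0 M0]; apply/eqP => e.
have: (1 + c%:R * j0) = - (1 - c%:R * j0) by rewrite -mulN1r -e /mobius mulfVK.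
move/eqP; rewrite -addr_eq0 (_ : _ + _ = 2); last by ring.
by rewrite (negbTE two_K).
Qed.

Lemma mobius_inj c d : (c < l)%N -> (d < l)%N -> ~~ (l %| c ^ 2 + 1)%N ->
  ~~ (l %| d ^ 2 + 1)%N -> mobius c = mobius d -> c = d.
Proof.
move=> cl dl /mobius_den[P0 M0] /mobius_den[P0' M0'].
rewrite /mobius => /eqP; rewrite eqr_div // => /eqP e.
have : 2 * j0 * (c%:R - d%:R) = 0.
  have -> : 2 * j0 * (c%:R - d%:R) = (1 + c%:R * j0) * (1 - d%:R * j0) -
    (1 + d%:R * j0) * (1 - c%:R * j0) by ring.
  by rewrite e subrr.
move/eqP; rewrite !mulf_eq0 (negbTE two_K) (negbTE (i_neq0 j02)) /= => /eqP cd.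
wlog dc : c d cl dl {P0 M0 P0' M0' e} cd / (d <= c)%N.
  move=> W; case: (leqP d c) => [|/ltnW] h; first exact: W.
  by apply/esym/W => //; rewrite -opprB cd oppr0.
move: cd; rewrite -natrB // => /eqP; rewrite -(dvdn_pcharf chK) => ld.
case: (ltnP d c) => [dc'|cd]; last by apply/eqP; rewrite eqn_leq cd.
move: ld; rewrite gtnNdvd ?subn_gt0 //.
exact: leq_ltn_trans (leq_subr _ _) cl.
Qed.

(** X^l - X has no roots beyond the l elements of the prime field. *)
Lemma frob_fixed (c : K) : c ^+ l = c -> exists2 n, (n < l)%N & c = n%:R.
Proof.
move=> cl; have l1 := prime_gt1 l_pr.
pose q : {poly K} := 'X^l - 'X.
have sq : size q = l.+1 by rewrite size_polyDl ?size_polyXn // size_polyN size_polyX.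
have q0 : q != 0 by rewrite -size_poly_eq0 sq.
have rootq (a : K) : root q a = (a ^+ l == a).
  by rewrite rootE !hornerE subr_eq0.
have natl n : (n%:R : K) ^+ l = n%:R.
  by rewrite -(pFrobenius_autE chK) rmorph_nat.
have [/mapP[n]|nc] := boolP (c \in [seq n%:R | n <- iota 0 l]).
  by rewrite mem_iota add0n => /= nl ->; exists n.
have := max_poly_roots (rs := c :: [seq n%:R | n <- iota 0 l]) q0.
rewrite /= nc rootq cl eqxx size_map size_iota sq ltnn.
have -> : all (root q) [seq n%:R | n <- iota 0 l].
  by apply/allP => _ /mapP[n _ ->]; rewrite rootq natl.
rewrite map_inj_in_uniq ?iota_uniq; first by move=> /(_ isT isT).
move=> a b; rewrite !mem_iota !add0n /= => al bl ab.
wlog ba : a b al bl ab / (b <= a)%N.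
  by move=> W; case: (leqP b a) => [|/ltnW] h; [apply: W | apply/esym/W].
have /eqP := ab; rewrite -subr_eq0 -natrB // -(dvdn_pcharf chK) => ld.
case: (ltnP b a) => [ab'|ab']; last by apply/eqP; rewrite eqn_leq ab'.
by move: ld; rewrite gtnNdvd ?subn_gt0 // (leq_ltn_trans (leq_subr _ _) al).
Qed.

(** The inverse transformation w |-> (w - 1)/(j0 (w + 1)) yields an element
    fixed by Frobenius, hence a residue modulo l. *)
Lemma mobius_surj (w : K) : w ^+ (4 * m) = 1 -> w != -1 ->
  exists c, [/\ (c < l)%N, ~~ (l %| c ^ 2 + 1)%N & mobius c = w].
Proof.
move=> w1; rewrite -addr_eq0 => wN1.
have w0 : w != 0.
  apply: contra_eq_neq w1 => ->; rewrite expr0n muln_eq0 /= gtn_eqF //.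
  by rewrite eq_sym oner_eq0.
have j00 := i_neq0 j02.
pose c := (w - 1) / (j0 * (w + 1)).
have cj : c * j0 = (w - 1) / (w + 1).
  by rewrite /c; field; rewrite ?j00 ?wN1.
have PE : 1 + c * j0 = 2 * w / (w + 1) by rewrite cj; field.
have ME : 1 - c * j0 = 2 / (w + 1) by rewrite cj; field.
have frobB (a b : K) : (a - b) ^+ l = a ^+ l - b ^+ l.
  by rewrite -!(pFrobenius_autE chK) rmorphB.
have frobD (a b : K) : (a + b) ^+ l = a ^+ l + b ^+ l.
  by rewrite -!(pFrobenius_autE chK) rmorphD.
have cl : c ^+ l = c.
  rewrite /c exprMn exprVn exprMn frobB frobD expr1n j0l.
  move: w1; rewrite lm; case: s => w1.
    have -> : w ^+ l = w by rewrite -{2}[w]mul1r -w1 -exprSr prednK ?prime_gt0.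
    by [].
  have -> : w ^+ l = w^-1 by apply: (mulfI w0); rewrite -exprS w1 divff.
  by field; rewrite w0 j00 wN1 oppr_eq0 j00.
have [n nl cn] := frob_fixed cl.
exists n; split=> //.
  rewrite (dvdn_pcharf chK) -mobius_norm -cn PE ME.
  by rewrite !mulf_neq0 ?invr_neq0.
by rewrite /mobius -cn PE ME; field; rewrite two_K wN1.
Qed.

Let l_K : (4 * m)%:R != 0 :> K.
Proof.
rewrite -(dvdn_pcharf chK) lm; have l1 := prime_gt1 l_pr; case: s.
  by rewrite gtnNdvd //; move: l1; clear; lia.
by rewrite -addn1 dvdn_addr // dvdn1; apply: contraTneq l1 => ->.
Qed.

(** The residues c with c^2 + 1 prime to l parametrise the 4m-th roots of unity
    other than -1 = r^(2m). *)
Lemma sum_mobius (L : nmodType) (f : K -> L) r : (4 * m).-primitive_root r ->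
  \sum_(0 <= c < l | ~~ (l %| c ^ 2 + 1)%N) f (mobius c) =
  \sum_(0 <= n < 4 * m | n != (2 * m)%N) f (r ^+ n).
Proof.
move=> rP.
have r2m : r ^+ (2 * m) = -1.
  have : (r ^+ (2 * m)) ^+ 2 = 1 by rewrite -exprM mulnAC (prim_expr_order rP).
  move/eqP; rewrite sqrf_eq1 -(prim_order_dvd rP) gtnNdvd /= ?muln_gt0 ?m_gt0 //.
    by move/eqP.
  by rewrite ltn_mul2r m_gt0.
rewrite -[LHS]big_filter -[RHS]big_filter.
rewrite -(big_map mobius xpredT f) -(big_map (fun n => r ^+ n) xpredT f).
apply: perm_big; apply: uniq_perm.
- rewrite map_inj_in_uniq ?filter_uniq ?iota_uniq // => c d.
  rewrite !mem_filter !mem_index_iota => /andP[c1 /andP[_ c2]] /andP[d1 /andP[_ d2]].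
  exact: mobius_inj.
- rewrite map_inj_in_uniq ?filter_uniq ?iota_uniq // => a b.
  rewrite !mem_filter !mem_index_iota => /andP[_ /andP[_ a2]] /andP[_ /andP[_ b2]].
  by move/eqP; rewrite (eq_prim_root_expr rP) !modn_small // => /eqP.
move=> w; apply/mapP/mapP => [[c]|[n]].
  rewrite mem_filter mem_index_iota => /andP[cadm _] ->.
  have /(prim_rootP rP)[n e] := mobius_unity cadm.
  exists (n : nat) => //; rewrite mem_filter mem_index_iota ltn_ord /= andbT.
  by apply: contra_neq (mobiusN1 cadm) => n2; rewrite e n2.
rewrite mem_filter mem_index_iota => /andP[n2 /andP[_ n4]] ->.
have [||c [cl cadm cE]] := mobius_surj (w := r ^+ n).
- by rewrite -exprM mulnC exprM (prim_expr_order rP) expr1n.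
- rewrite -r2m (eq_prim_root_expr rP) !modn_small // ltn_mul2r m_gt0 //.
by exists c => //; rewrite mem_filter mem_index_iota cadm.
Qed.

Variables (L : fieldType) (i : L).
Hypotheses (two_L : (2 : L) != 0) (i2 : i ^+ 2 = -1).

Definition local_sym (c : nat) : L := mu4_map j i (local_arg l j c).

Lemma local_sym_period c : local_sym (c %% l) = local_sym c.
Proof. by rewrite /local_sym !local_argE mobius_period. Qed.

Lemma local_sym0 c : (l %| c ^ 2 + 1)%N -> local_sym c = 0.
Proof.
move=> h; rewrite /local_sym local_argE mobius0 // expr0n gtn_eqF ?m_gt0 //.
by rewrite mu4_map0.
Qed.

Let arg_pow4 c : ~~ (l %| c ^ 2 + 1)%N -> local_arg l j c ^+ 4 = 1.
Proof. by move=> h; rewrite local_argE -exprM mulnC mobius_unity. Qed.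

Lemma local_sym_pow4 c : ~~ (l %| c ^ 2 + 1)%N -> local_sym c ^+ 4 = 1.
Proof. by move=> /arg_pow4 h; rewrite /local_sym mu4_map_pow4. Qed.

(** Over all 4m-th roots of unity the sum is 4m or 0, according to whether 4
    divides e; what is subtracted is the term of the missing element -1, with
    value (-1)^(e m). *)
Lemma sum_local_sym e : (0 < e)%N ->
  \sum_(0 <= c < l) local_sym c ^+ e =
  if (4 %| e)%N then (tau_prime l)%:R else if odd e then - (-1) ^+ m else -1.
Proof.
move=> e0; have [r rP] := closed_prim_root l_K.
have rm4 : (r ^+ m) ^+ 4 = 1 by rewrite -exprM mulnC (prim_expr_order rP).
pose t := mu4_map j i (r ^+ m).
have t2 : t ^+ 2 = -1.
  have : r ^+ m ^+ 2 = -1.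
    have /eqP := rm4; rewrite (exprM _ 2 2) sqrf_eq1 => /orP[|/eqP //].
    rewrite -exprM -(prim_order_dvd rP) gtnNdvd //= ?muln_gt0 ?m_gt0 //.
    by rewrite mulnC ltn_mul2r m_gt0.
  by rewrite /t -mu4_map_exp // => ->; rewrite -j2 mu4_mapX.
transitivity (\sum_(0 <= n < 4 * m | n != (2 * m)%N) (t ^+ e) ^+ n).
  rewrite (bigID (fun c => ~~ (l %| c ^ 2 + 1)%N)) /= [X in _ + X]big1 ?addr0; last first.
    by move=> c /negPn/local_sym0->; rewrite expr0n gtn_eqF.
  under eq_bigr do rewrite /local_sym local_argE.
  rewrite (sum_mobius (fun w => mu4_map j i (w ^+ m) ^+ e) rP).
  apply: eq_bigr => n _.
  have -> : (r ^+ n) ^+ m = (r ^+ m) ^+ n by rewrite -!exprM mulnC.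
  by rewrite mu4_map_exp // -/t -!exprM mulnC.
have nm2 : (2 * m < 4 * m)%N by rewrite ltn_mul2r m_gt0.
have tot : \sum_(0 <= n < 4 * m) (t ^+ e) ^+ n =
    \sum_(0 <= n < 4 * m | n != (2 * m)%N) (t ^+ e) ^+ n + (-1) ^+ (e * m).
  rewrite (bigD1_seq (2 * m)%N) ?iota_uniq ?mem_index_iota //= addrC; congr (_ + _).
  by rewrite -exprM mulnCA exprM t2.
have sgn : (-1) ^+ (e * m) = if odd e then (-1) ^+ m else 1 :> L.
  by rewrite exprM -(signr_odd _ e); case: odd; rewrite ?expr1 // expr0 expr1n.
rewrite -[LHS](addrK ((-1) ^+ (e * m))) -tot sgn.
have t4 : t ^+ 4 = 1 by rewrite (exprM _ 2 2) t2 sqrrN expr1n.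
case: (boolP (4 %| e)%N) => e4.
  have te : t ^+ e = 1 by move: e4 => /dvdnP[q ->]; rewrite mulnC exprM t4 expr1n.
  rewrite te (_ : odd e = false); last by move: e4; clear; lia.
  under eq_bigr do rewrite expr1n.
  rewrite big_const_nat subn0 iter_addr_0 -[X in _ - X]/(1%:R) -natrB ?muln_gt0 ?m_gt0 //.
  congr _%:R; rewrite lm /tau_prime /s; move: l_odd; clear.
  by case: eqP => [e1|]; case: eqP => [e3|]; lia.
have te1 : t ^+ e != 1.
  rewrite (i_mod4 t2) (divn_eq e 4) modnMDl modn_mod.
  have := mu4_distinct two_L t2; rewrite /= !inE !negb_or => /andP[/and3P[h1 h2 h3] _].
  have : (e %% 4 < 4)%N by rewrite ltn_mod.
  move: e4; rewrite /dvdn; case: (e %% 4)%N => [|[|[|[|]]]] // _ _.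
  - by rewrite expr1 eq_sym.
  - by rewrite t2 eq_sym.
  - by rewrite exprSr t2 mulN1r eq_sym.
have -> : \sum_(0 <= n < 4 * m) (t ^+ e) ^+ n = 0.
  have /esym/eqP := subrX1 (t ^+ e) (4 * m).
  rewrite -exprM mulnCA exprM t4 expr1n subrr mulf_eq0 subr_eq0 (negbTE te1) /=.
  by rewrite big_mkord => /eqP.
by rewrite sub0r; case: odd.
Qed.
End LocalSums.

(** * The quartic symbol of 2 *)

Section SymbolOfTwo.
Variables (L : fieldType) (i : L).
Hypotheses (two_L : (2 : L) != 0) (i2 : i ^+ 2 = -1).

(** At c = -1 the fraction (1 + c j)/(1 - c j) is -j. *)
Lemma local_sym_sq_dvd (l : nat) (K : closedFieldType) (j : K) c :
  prime l -> odd l -> l \in [pchar K] -> j ^+ 2 = -1 -> (l %| c.+1)%N ->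
  local_sym l j i c ^+ 2 = (-1) ^+ (l.+1 %/ 4).
Proof.
move=> l_pr l_odd chK j2 lc.
have cN1 : c%:R = -1 :> K.
  by apply/eqP; rewrite -addr_eq0 natr1 -(dvdn_pcharf chK).
have two_K : (2 : K) != 0.
  rewrite -(dvdn_pcharf chK) dvdn_prime2 //.
  by apply: contraTneq l_odd => ->.
have D1 : (1 - j) * (1 + j) = 2.
  by transitivity (1 - j ^+ 2); [ring | rewrite j2; ring].
have D1' : 1 - j != 0 by apply: contraNneq two_K => h; rewrite -D1 h mul0r.
have D2' : 1 + j != 0 by apply: contraNneq two_K => h; rewrite -D1 h mulr0.
rewrite /local_sym /local_arg cN1 !mulN1r opprK.
have -> : (1 - j) / (1 + j) = j ^+ 3.
  apply: (mulIf D2'); rewrite mulfVK // exprSr j2.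
  by transitivity (- j - j ^+ 2); [rewrite j2; ring | ring].
have -> : (1 + j) / (1 - j) = j.
  by apply: (mulIf D1'); rewrite mulfVK // mulrBr mulr1 -expr2 j2; ring.
case: ifP => l4.
  rewrite -exprM mu4_mapX // -exprM mulnC exprM i2.
  rewrite -[LHS]signr_odd oddM /= -[RHS]signr_odd.
  by congr (_ ^+ nat_of_bool _); move: l4 l_odd; clear; lia.
rewrite mu4_mapX // -exprM mulnC exprM i2; congr (_ ^+ _).
by move: l4 l_odd; clear; lia.
Qed.

(** What is used of the local symbol at l; the last two clauses are reciprocity
    and the value at c = -1, which is the residue of x at the primes dividing 1
    + x. *)
Definition local_symbol (l : nat) (psi : nat -> L) : Prop :=
  [/\ forall c, psi (c %% l)%N = psi c,
      forall c, (l %| c ^ 2 + 1)%N -> psi c = 0,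
      forall c, ~~ (l %| c ^ 2 + 1)%N -> psi c ^+ 4 = 1,
      forall e, (0 < e)%N -> \sum_(0 <= c < l) psi c ^+ e =
        if (4 %| e)%N then (tau_prime l)%:R else
        if odd e then - (-1) ^+ (l.+1 %/ 4) else -1 &
      (forall p y, prime p -> p = (4 * y ^ 2).+1 -> l != p ->
        quart y i ((lstar l)%:~R : 'F_p) = psi (2 * y)%N) /\
      (forall c, (l %| c.+1)%N -> psi c ^+ 2 = (-1) ^+ (l.+1 %/ 4))].

Lemma local_symbol_exists (l : nat) : prime l -> odd l ->
  exists psi : nat -> L, local_symbol l psi.
Proof.
move=> l_pr l_odd.
have [K [FtoK _]] := countable_algebraic_closure 'F_l.
have chK : l \in [pchar K].
  by rewrite inE l_pr /= -(rmorph_nat FtoK) Fp_p0 // rmorph0.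
have two_K : (2 : K) != 0.
  rewrite -(dvdn_pcharf chK) dvdn_prime2 //.
  by apply: contraTneq l_odd => ->.
have [j jP] : exists j : K, root ('X^2 + 1%:P) j.
  by apply/closed_rootP; rewrite size_polyDl ?size_polyXn // size_polyC oner_eq0.
have j2 : j ^+ 2 = -1.
  by apply/eqP; rewrite -addr_eq0; move: jP; rewrite rootE !hornerE.
exists (local_sym l j i); split=> //.
- by move=> c; apply: local_sym_period.
- by move=> c; apply: local_sym0.
- by move=> c; apply: local_sym_pow4.
- by move=> e; apply: sum_local_sym.
split; last by move=> c; apply: local_sym_sq_dvd.
move=> p y p_pr pE lp.
have p_K : p%:R != 0 :> K by rewrite -(dvdn_pcharf chK) dvdn_prime2.
have [z zP] := closed_prim_root p_K.
have z1 : z != 1.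
  by rewrite -[z]expr1 -(prim_order_dvd zP) dvdn1 neq_ltn prime_gt1 ?orbT.
rewrite /local_sym -(quart_recip p_pr pE l_pr l_odd lp chK j2 (prim_expr_order zP) z1).
rewrite /quart mu4_map_comp ?(Fp_iK p_pr pE) ?(Fp_two p_pr pE) //.
apply: Fp_fermat => //; rewrite /lstar; case: ifP => _; rewrite ?intrN ?oppr_eq0;
by rewrite -pmulrn (Fp_natr_eq0 p_pr) dvdn_prime2 // eq_sym.
Qed.

(** The second supplementary character, n |-> (2/n). *)
Definition eps8 (n : nat) : L := if (n %% 8 == 1)%N || (n %% 8 == 7)%N then 1 else -1.

Lemma eps8M a b : odd a -> odd b -> eps8 (a * b) = eps8 a * eps8 b.
Proof.
move=> oa ob; rewrite /eps8 -modnMm.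
have : (a %% 8 \in [:: 1; 3; 5; 7])%N by rewrite !inE; move: oa; clear; lia.
have : (b %% 8 \in [:: 1; 3; 5; 7])%N by rewrite !inE; move: ob; clear; lia.
rewrite !inE; case/or4P=> /eqP->; case/or4P=> /eqP->;
  by rewrite /= ?mul1r ?mulr1 ?mulN1r ?opprK.
Qed.

Variables (p y : nat).
Hypotheses (p_pr : prime p) (pE : p = (4 * y ^ 2).+1).
#[local] Opaque quart.

Let chiM := quart_mulchar p_pr pE i2.

Let chiN a : quart y i (- a : 'F_p) ^+ 2 = quart y i a ^+ 2.
Proof.
have [_ _ cM] := chiM.
by rewrite -mulN1r cM (quartN1 p_pr pE i2) exprMn sqrr_sign mul1r.
Qed.

(** By reciprocity at c = -1 this holds for prime d, and both sides are
    multiplicative in d. *)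
Lemma quart_sq_dvd d : odd d -> (d %| (2 * y).+1)%N ->
  quart y i (d%:R : 'F_p) ^+ 2 = eps8 d.
Proof.
have [_ c1 cM] := chiM.
elim/ltn_ind: d => d IH d_odd dy.
have [d1|d1] := leqP d 1.
  have -> : d = 1%N by case: d d1 d_odd {IH dy} => [|[]].
  by rewrite mulr1n c1 expr1n.
have l_pr := pdiv_prime d1; set l := pdiv d in l_pr.
have ld : (l %| d)%N := pdiv_dvd d.
have [d' dE] : exists d', d = (l * d')%N.
  by exists (d %/ l)%N; rewrite mulnC divnK.
have l_odd : odd l by apply: dvdn_odd ld d_odd.
have d'_odd : odd d' by move: d_odd; rewrite dE oddM => /andP[].
have d'_gt0 : (0 < d')%N by case: (d') d'_odd.
have d'd : (d' < d)%N by rewrite dE ltn_Pmull ?prime_gt1.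
have d'y : (d' %| (2 * y).+1)%N by apply: dvdn_trans dy; rewrite dE dvdn_mull.
rewrite [in LHS]dE natrM cM exprMn (IH _ d'd) // [in RHS]dE eps8M //.
congr (_ * _).
have ly := dvdn_trans ld dy.
have lp : l != p.
  have := dvdn_leq (ltn0Sn _) ly; apply: contraTneq => ->; rewrite pE -ltnNge ltnS.
  by have := y_gt0 p_pr pE; move: (y); clear=> t; nia.
have [psi [_ _ _ _ [rec root]]] := local_symbol_exists l_pr l_odd.
transitivity (quart y i ((lstar l)%:~R : 'F_p) ^+ 2).
  by rewrite /lstar; case: ifP => _; rewrite ?intrN -pmulrn ?chiN.
rewrite (rec _ _ p_pr pE lp) root // /eps8 -signr_odd.
case: ifP => h; [have -> : odd (l.+1 %/ 4) = false | have -> : odd (l.+1 %/ 4)] => //;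
by move: h l_odd; clear; lia.
Qed.

(** Since (1 + x)^2 = 2 x mod p, chi(2) chi(x) = chi(1 + x)^2, which is (2/(1 +
    x)), while chi(x) = i^(y^2). *)
Lemma quart2 : quart y i (2 : 'F_p) = i ^+ y.
Proof.
have [_ c1 cM] := chiM.
have X2 := Fp_iK p_pr pE.
have i0 := i_neq0 i2.
have : quart y i (2 * Fp_i p y : 'F_p) = eps8 (2 * y).+1.
  have odd1 : odd (2 * y).+1 by rewrite /= oddM.
  rewrite -(quart_sq_dvd odd1 (dvdnn _)) -(mulcharX _ _ chiM).
  congr (quart _ _ _).
  transitivity ((1 + Fp_i p y) ^+ 2 - (1 + Fp_i p y ^+ 2)); first by ring.
  by rewrite X2 subrr subr0 /Fp_i -natr1 addrC.
have -> : quart y i (2 * Fp_i p y : 'F_p) = quart y i (2 : 'F_p) * i ^+ (y ^ 2).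
  rewrite cM; congr (_ * _).
  Transparent quart.
  by rewrite /quart mu4_mapX // (Fp_two p_pr pE).
move=> e; apply: (mulIf (expf_neq0 (y ^ 2) i0)); rewrite e.
rewrite -exprD (i_mod4 i2) /eps8.
have -> : ((2 * y).+1 %% 8 = (2 * (y %% 4)).+1)%N by clear; lia.
have -> : ((y + y ^ 2) %% 4 = (y %% 4 + (y %% 4) ^ 2) %% 4)%N 
  by rewrite -modnDm -modnXm modnDmr.
have : (y %% 4 < 4)%N by rewrite ltn_mod.
by case: (y %% 4)%N => [|[|[|[|]]]] //= _; rewrite ?expr0.
Qed.
End SymbolOfTwo.

(** * Sums over residues and the Chinese remainder theorem *)

Section CRTSums.
Variable L : comNzRingType.
Implicit Types f g : nat -> L.

Definition periodic (m : nat) f := forall c, f (c %% m)%N = f c.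

Lemma crt_sum2 m n f g : coprime m n -> (0 < m)%N -> (0 < n)%N ->
  periodic m f -> periodic n g ->
  \sum_(0 <= c < m * n) f c * g c =
  (\sum_(0 <= c < m) f c) * \sum_(0 <= c < n) g c.
Proof.
move=> co m0 n0 fP gP; rewrite !big_mkord big_distrl /=.
under [RHS]eq_bigr do rewrite big_distrr /=.
rewrite pair_big /=.
have mn0 : (0 < m * n)%N by rewrite muln_gt0 m0.
pose h (P : 'I_m * 'I_n) : 'I_(m * n) :=
  Ordinal (ltn_pmod (chinese m n P.1 P.2) mn0).
rewrite (reindex h) /=; last first.
  exists (fun c : 'I_(m * n) => (Ordinal (ltn_pmod c m0), Ordinal (ltn_pmod c n0))).
    move=> [a b] _; congr pair; apply: val_inj => /=.
      by rewrite modn_dvdm ?dvdn_mulr // chinese_modl // modn_small.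
    by rewrite modn_dvdm ?dvdn_mull // chinese_modr // modn_small.
  move=> c _; apply: val_inj => /=.
  by rewrite -chinese_mod // modn_small.
apply: eq_bigr => -[a b] _ /=; congr (_ * _).
  by rewrite -fP modn_dvdm ?dvdn_mulr // chinese_modl // fP.
by rewrite -gP modn_dvdm ?dvdn_mull // chinese_modr // gP.
Qed.

Lemma periodic_dvd m n f : (m %| n)%N -> periodic m f -> periodic n f.
Proof. by move=> mn fP c; rewrite -fP modn_dvdm // fP. Qed.

Lemma crt_sum m f (G : nat -> nat -> L) (s : seq nat) :
  (0 < m)%N -> uniq s -> all prime s -> all (fun l => coprime m l) s ->
  periodic m f -> (forall l, l \in s -> periodic l (G l)) ->
  \sum_(0 <= c < m * \prod_(l <- s) l) f c * (\prod_(l <- s) G l c) =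
  (\sum_(0 <= c < m) f c) * \prod_(l <- s) \sum_(0 <= c < l) G l c.
Proof.
elim: s m f => [|l s IH] m f m0.
  rewrite !big_nil muln1 mulr1 => *; apply: eq_bigr => c _.
  by rewrite big_nil mulr1.
move=> /= /andP[ls us] /andP[lp sp] /andP[ml ms] fP GP.
rewrite !big_cons mulnA.
under eq_bigr do rewrite big_cons mulrA.
rewrite (IH (m * l)%N (fun c => f c * G l c)) //.
- by rewrite (crt_sum2 ml m0 (prime_gt0 lp) fP (GP l (mem_head _ _))) mulrA.
- by rewrite muln_gt0 m0 prime_gt0.
- apply/allP => q qs; rewrite coprimeMl (allP ms) //=.
  rewrite prime_coprime // dvdn_prime2 // ?(allP sp) //.
  by apply: contraNneq ls => ->.
- move=> c; rewrite (periodic_dvd _ fP) ?dvdn_mulr //.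
  by rewrite (periodic_dvd _ (GP l _)) ?dvdn_mull ?mem_head.
- by move=> q qs; apply: GP; rewrite inE qs orbT.
Qed.
End CRTSums.

(** * Counting residue classes by the value of the symbol *)

Section ResidueCounts.
Variables (L : numFieldType) (i : L).
Hypotheses (i2 : i ^+ 2 = -1).

Variables (ps qs ls : seq nat) (psi : nat -> nat -> L).
Local Notation LL := (ps ++ qs ++ ls).
Hypothesis hodd_prime : all (fun p => prime p && odd p) LL.
Hypothesis hdistinct : uniq LL.
Hypothesis psiP : forall l, prime l -> odd l -> local_symbol i l (psi l).

Definition expo (l : nat) : nat :=
  if l \in ps then 1 else if l \in qs then 2 else 3.

Definition modulus : nat := (8 * \prod_(l <- LL) l)%N.

Variables (eta : L).
Hypothesis eta4 : eta ^+ 4 = 1.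

(** The 2-adic factor of the symbol: p = 1 + c^2 is an odd prime only for even
    c, and then the contribution of -1 and 2 is the power c/2 of a fixed fourth
    root of unity. *)
Definition two_part (c : nat) : L := if odd c then 0 else eta ^+ c./2.

Definition sym_value (c : nat) : L :=
  two_part c * \prod_(l <- LL) psi l c ^+ expo l.

Let LL_pr l : l \in LL -> prime l.
Proof. by move=> /(allP hodd_prime)/andP[]. Qed.
Let LL_odd l : l \in LL -> odd l.
Proof. by move=> /(allP hodd_prime)/andP[]. Qed.

Lemma expo_gt0 l : (0 < expo l)%N.
Proof. by rewrite /expo; case: ifP => //; case: ifP. Qed.

Lemma expo_ps l : l \in ps -> expo l = 1%N.
Proof. by rewrite /expo => ->. Qed.
Lemma expo_qs l : l \in qs -> expo l = 2%N.
Proof.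
rewrite /expo => lq; rewrite lq; case: ifP => // lp.
move: hdistinct; rewrite cat_uniq => /and3P[_ /hasPn/(_ l) h _].
by move: h; rewrite mem_cat lq => /(_ isT); rewrite lp.
Qed.
Lemma expo_ls l : l \in ls -> expo l = 3%N.
Proof.
rewrite /expo => lq; move: hdistinct; rewrite !cat_uniq.
case/and3P=> [_ /hasPn/(_ l) h /and3P[_ /hasPn/(_ l) h2 _]].
move: h; rewrite mem_cat lq orbT => /(_ isT)/negbTE->.
by move: h2; rewrite lq => /(_ isT)/negbTE->.
Qed.

Lemma modulus_gt0 : (0 < modulus)%N.
Proof.
rewrite muln_gt0 /= big_seq prodn_cond_gt0 // => l /LL_pr; exact: prime_gt0.
Qed.

Lemma two_part_period : periodic 8 two_part.
Proof.
move=> c; rewrite /two_part.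
have -> : odd (c %% 8) = odd c by clear; lia.
case: ifP => // ce; rewrite [in RHS](_ : c./2 = (c %% 8)./2 + 4 * (c %/ 8))%N.
  by rewrite exprD exprM eta4 expr1n mulr1.
by clear; lia.
Qed.

Lemma sum_two_part j : (0 < j <= 4)%N ->
  \sum_(0 <= c < 8) two_part c ^+ j = if eta ^+ j == 1 then 4 else 0.
Proof.
case/andP=> j0 j4.
have -> : \sum_(0 <= c < 8) two_part c ^+ j =
    1 + eta ^+ j + (eta ^+ j) ^+ 2 + (eta ^+ j) ^+ 3.
  rewrite !big_nat_recl // big_geq // /two_part /= !expr0n gtn_eqF //= expr1n.
  have e n : (eta ^+ n) ^+ j = (eta ^+ j) ^+ n by rewrite -!exprM mulnC.
  rewrite !(e 2) !(e 3); ring.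
case: eqP => [->|/eqP h]; first by rewrite !expr1n; ring.
have : (eta ^+ j - 1) * (1 + eta ^+ j + (eta ^+ j) ^+ 2 + (eta ^+ j) ^+ 3) = 0.
  transitivity ((eta ^+ j) ^+ 4 - 1); first by ring.
  by rewrite -exprM mulnC exprM eta4 expr1n subrr.
by move/eqP; rewrite mulf_eq0 subr_eq0 (negbTE h) => /eqP.
Qed.

Lemma sym_value_unit c :
  if coprime modulus (c ^ 2 + 1) then sym_value c ^+ 4 = 1 else sym_value c = 0.
Proof.
have h8 : coprime 8 (c ^ 2 + 1) = ~~ odd c.
  by rewrite (@coprime_pexpl 3 2) // coprime2n oddD oddX /= addbT.
rewrite coprimeMl h8 /sym_value /two_part; case: (odd c) => /=.
  by rewrite mul0r.
case: ifP => co.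
  rewrite exprMn -exprM mulnC exprM eta4 expr1n mul1r -prodrXl big1_seq // => l.
  move=> /andP[_ lLL]; have [_ _ u4 _ _] := psiP (LL_pr lLL) (LL_odd lLL).
  rewrite -exprM mulnC exprM u4 ?expr1n //; move: co; apply: contraL.
  move=> ld; rewrite (bigD1_seq l) //= coprimeMl.
  by rewrite prime_coprime ?LL_pr // ld.
suff [l lLL ld] : exists2 l, l \in LL & (l %| c ^ 2 + 1)%N.
  rewrite (bigD1_seq l) //=; have [_ z _ _ _] := psiP (LL_pr lLL) (LL_odd lLL).
  by rewrite z // expr0n gtn_eqF ?expo_gt0 // mul0r mulr0.
apply/hasP; move/negbT: co; apply: contraR => /hasPn h.
have: all prime LL by apply/allP => l; exact: LL_pr.
move: h; elim: (LL) => [|l s IH] h; first by rewrite big_nil coprime1n.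
move=> /= /andP[lp sp]; rewrite big_cons coprimeMl prime_coprime //.
by rewrite h ?mem_head //= IH // => q qs'; rewrite h // inE qs' orbT.
Qed.

Lemma sym_value_period : periodic modulus sym_value.
Proof.
move=> c; rewrite /sym_value (periodic_dvd _ two_part_period) ?dvdn_mulr //.
congr (_ * _); apply: eq_big_seq => l lLL; congr (_ ^+ _).
have [pe _ _ _ _] := psiP (LL_pr lLL) (LL_odd lLL).
apply: (periodic_dvd _ pe); rewrite /modulus dvdn_mull //.
by rewrite (bigD1_seq l) //= dvdn_mulr.
Qed.

Definition prod_tau (s : seq nat) : nat := \prod_(l <- s) tau_prime l.
Definition count_pm1_mod8 (s : seq nat) : nat := count_mod8 1 s + count_mod8 7 s.

Lemma sum_sym_value j : (0 < j <= 4)%N ->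
  \sum_(0 <= c < modulus) sym_value c ^+ j =
  (if eta ^+ j == 1 then 4 else 0) *
  \prod_(l <- LL) (let e := (expo l * j)%N in
     if (4 %| e)%N then (tau_prime l)%:R else
     if odd e then - (-1) ^+ (l.+1 %/ 4) else -1).
Proof.
move=> j4; have j0 : (0 < j)%N by case/andP: j4.
rewrite -sum_two_part //.
transitivity (\sum_(0 <= c < modulus) two_part c ^+ j *
    \prod_(l <- LL) psi l c ^+ (expo l * j)).
  apply: eq_bigr => c _; rewrite exprMn -prodrXl; congr (_ * _).
  by apply: eq_bigr => l _; rewrite exprM.
rewrite (crt_sum (f := fun c => two_part c ^+ j)
  (G := fun l c => psi l c ^+ (expo l * j))) //.
- congr (_ * _); apply: eq_big_seq => l lLL /=.
  have [_ _ _ sm _] := psiP (LL_pr lLL) (LL_odd lLL).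
  by rewrite sm // muln_gt0 expo_gt0.
- by apply/allP => l; exact: LL_pr.
- apply/allP => l /LL_odd; rewrite (@coprime_pexpl 3 2) // coprime2n //.
- by move=> c; rewrite two_part_period.
- move=> l lLL c; have [pe _ _ _ _] := psiP (LL_pr lLL) (LL_odd lLL).
  by rewrite pe.
Qed.

Lemma sum_sym_value4 :
  \sum_(0 <= c < modulus) sym_value c ^+ 4 = (4 * prod_tau LL)%:R.
Proof.
rewrite sum_sym_value // eta4 eqxx natrM; congr (_ * _).
rewrite /prod_tau rmorph_prod; apply: eq_big_seq => l lLL /=.
by rewrite dvdn_mull.
Qed.

Lemma sum_sym_value2 :
  \sum_(0 <= c < modulus) sym_value c ^+ 2 =
  (if eta ^+ 2 == 1 then 4 else 0) * ((-1) ^+ (size ps + size ls) * (prod_tau qs)%:R).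
Proof.
rewrite sum_sym_value //; congr (_ * _); rewrite !big_cat /=.
rewrite (eq_big_seq (fun=> -1)) => [|l lp]; last by rewrite expo_ps.
rewrite [X in _ * (X * _)](eq_big_seq (fun l => (tau_prime l)%:R)) => [|l lp];
  last by rewrite expo_qs.
rewrite [X in _ * (_ * X)](eq_big_seq (fun=> -1)) => [|l lp]; last by rewrite expo_ls.
rewrite !big_const_seq !count_predT !iter_mulr_1 /prod_tau rmorph_prod exprD /=; ring.
Qed.

Lemma prod_eps s : all odd s ->
  \prod_(l <- s) (- (-1) ^+ (l.+1 %/ 4)) = (-1) ^+ count_pm1_mod8 s :> L.
Proof.
elim: s => [|l s IH] /=; first by rewrite big_nil.
case/andP=> lo so; rewrite big_cons IH // /count_pm1_mod8 /count_mod8 /= addnACA [RHS]exprD.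
congr (_ * _); rewrite -mulN1r -exprS -[LHS]signr_odd -[RHS]signr_odd.
congr (_ ^+ nat_of_bool _).
by move: lo; clear; lia.
Qed.

Lemma sum_sym_value13 j : j = 1%N \/ j = 3 ->
  \sum_(0 <= c < modulus) sym_value c ^+ j =
  (if eta == 1 then 4 else 0) * (-1) ^+ (count_pm1_mod8 ps + size qs + count_pm1_mod8 ls).
Proof.
move=> j13; rewrite sum_sym_value; last by case: j13 => ->.
have -> : (eta ^+ j == 1) = (eta == 1).
  case: j13 => ->; rewrite ?expr1 //; apply/eqP/eqP => [e|->]; last by rewrite expr1n.
  by move: eta4; rewrite exprS e mulr1.
have o l : l \in ps ++ ls -> all odd LL -> odd l.
  move=> lps /allP; apply; rewrite !mem_cat; move: lps; rewrite mem_cat.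
  by case/orP=> ->; rewrite ?orbT.
have oLL : all odd LL by apply/allP => l; exact: LL_odd.
congr (_ * _); rewrite !big_cat /=.
rewrite (eq_big_seq (fun l => - (-1) ^+ (l.+1 %/ 4))) => [|l lp]; last first.
  by rewrite expo_ps //; case: j13 => ->.
rewrite [X in _ * (X * _)](eq_big_seq (fun l => -1)) => [|l lp]; last first.
  by rewrite expo_qs //; case: j13 => ->.
rewrite [X in _ * (_ * X)](eq_big_seq (fun l => - (-1) ^+ (l.+1 %/ 4))) =>
  [|l lp]; last first.
  by rewrite expo_ls //; case: j13 => ->.
move: oLL; rewrite !all_cat => /and3P[ops _ ols].
by rewrite !prod_eps // big_const_seq count_predT iter_mulr_1 !exprD mulrA.
Qed.

Definition sym_count (z : L) : nat := \sum_(0 <= c < modulus) (sym_value c == z).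
Definition unit_count : nat := \sum_(0 <= c < modulus) coprime modulus (c ^ 2 + 1).

Lemma unit_countE : unit_count = (4 * prod_tau LL)%N.
Proof.
apply/eqP; rewrite -(eqr_nat L) -sum_sym_value4 /unit_count natr_sum.
apply/eqP/eq_bigr => c _; have := sym_value_unit c.
by case: ifP => _ ->; rewrite ?expr0n.
Qed.

(** For a fourth root of unity z, 4 [z = 1] = z + z^2 + z^3 + z^4 and 4 [z = -1]
    = -z + z^2 - z^3 + z^4; the same holds for z = 0, and the power sums of the
    symbol are known. *)
Lemma sym_countE (e : bool) :
  (sym_count ((-1) ^+ e))%:Z = (prod_tau LL)%:Z +
  (if eta ^+ 2 == 1 then 1 else 0) * ((-1) ^+ (size ps + size ls) * (prod_tau qs)%:Z) +
  (-1) ^+ e * (if eta == 1 then 2 else 0) *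
    (-1) ^+ (count_pm1_mod8 ps + size qs + count_pm1_mod8 ls).
Proof.
have two_L : (2 : L) != 0 by rewrite pnatr_eq0.
have pt c : (4 : L) * (sym_value c == (-1) ^+ e)%:R =
   sym_value c ^+ 4 + sym_value c ^+ 2 +
   (-1) ^+ e * (sym_value c ^+ 1 + sym_value c ^+ 3).
  have := sym_value_unit c; case: ifP => _; last first.
    by move=> ->; rewrite !expr0n /= eq_sym signr_eq0 addr0 !mulr0 addr0.
  move=> /(mu4P i2)[n n4 ->].
  have := mu4_distinct two_L i2; rewrite /= !inE !negb_or.
  case/and4P=> /and3P[h1 h2 h3] /andP[h4 h5] h6 _.
  have i3 : i ^+ 3 = - i by rewrite exprSr i2 mulN1r.
  have i4 : i ^+ 4 = 1 by rewrite (exprM _ 2 2) i2 sqrrN expr1n.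
  case: n n4 => [|[|[|[|]]]] // _; rewrite ?expr1 ?i2 ?i3 ?expr0 ?i4.
  - by case: e; rewrite ?expr1 ?expr0 ?eqxx ?(negbTE h2) /= ?expr1n; ring.
  - case: e; rewrite ?expr1 ?expr0 ?(negbTE h4) 1?[i == 1]eq_sym ?(negbTE h1) /=;
      ring: i2 i3.
  - by case: e; rewrite ?expr1 ?expr0 1?eq_sym ?eqxx ?(negbTE h2) /=; ring.
  - have Ni2 : (- i) ^+ 2 = -1 by rewrite sqrrN.
    by case: e; rewrite ?expr1 ?expr0 1?eq_sym ?(negbTE h6) ?(negbTE h3) /=; ring: i2.
apply: (@mulfI _ (4 : int)) => //; apply/eqP; rewrite -(eqr_int L).
rewrite !rmorphM /= -pmulrn natr_sum big_distrr /=.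
under eq_bigr do rewrite pt.
rewrite !big_split /= -big_distrr /= big_split /=.
rewrite sum_sym_value4 sum_sym_value2 !sum_sym_value13; [|by right|by left].
apply/eqP.
case: ifP => _; case: ifP => _;
  rewrite ?(intrD, intrM, rmorphXn) /= ?rmorphN1 -?pmulrn natrM; ring.
Qed.
End ResidueCounts.

(** * The quartic symbol of D *)

Section SymbolOfD.
Variables (L : numFieldType) (i : L).
Hypotheses (i2 : i ^+ 2 = -1).
Variables (neg : bool) (sigma : nat) (ps qs ls : seq nat) (D : int).
Variable psi : nat -> nat -> L.
Local Notation LL := (ps ++ qs ++ ls).
Hypothesis hsigma : (sigma <= 3)%N.
Hypothesis hodd_prime : all (fun p => prime p && odd p) LL.
Hypothesis hdistinct : uniq LL.
Hypothesis psiP : forall l, prime l -> odd l -> local_symbol i l (psi l).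
Hypothesis hD : D = (-1) ^+ neg *
      (2 ^ sigma * prod_seq ps * prod_seq qs ^ 2 * prod_seq ls ^ 3)%N%:Z.

(** D is (-1)^sign_exp 2^sigma times a product of powers of the numbers lstar l,
    all of which are 1 mod 4. *)
Definition sign_exp : nat :=
  (neg + \sum_(l <- LL) expo ps qs l * (l %% 4 != 1))%N.

Definition twist : L := (-1) ^+ sign_exp * i ^+ sigma.

Lemma twist4 : twist ^+ 4 = 1.
Proof.
by rewrite /twist exprMn (exprM _ 2 2) sqrr_sign expr1n mul1r -exprM mulnC i_pow4.
Qed.

Lemma prod_expo :
  (prod_seq ps * prod_seq qs ^ 2 * prod_seq ls ^ 3)%N%:Z =
  \prod_(l <- LL) l%:Z ^+ expo ps qs l.
Proof.
rewrite !big_cat /= [RHS]mulrA (PoszM (_ * _)) (PoszM (prod_seq ps)); congr (_ * _ * _).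
- rewrite /prod_seq rmorph_prod; apply: eq_big_seq => l lp /=.
  by rewrite (expo_ps _ lp).
- rewrite -[(prod_seq qs ^ 2)%N%:Z]/((prod_seq qs ^+ 2)%:Z) rmorphXn /=.
  rewrite /prod_seq rmorph_prod -prodrXl; apply: eq_big_seq => l lp /=.
  by rewrite (expo_qs hdistinct lp).
- rewrite -[(prod_seq ls ^ 3)%N%:Z]/((prod_seq ls ^+ 3)%:Z) rmorphXn /=.
  rewrite /prod_seq rmorph_prod -prodrXl; apply: eq_big_seq => l lp /=.
  by rewrite (expo_ls hdistinct lp).
Qed.

Lemma D_factor : D = (-1) ^+ sign_exp * 2 ^+ sigma *
  \prod_(l <- LL) (lstar l) ^+ (expo ps qs l).
Proof.
have lE l : l%:Z = (-1) ^+ (l %% 4 != 1)%N * lstar l.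
  by rewrite /lstar; case: eqP => _; rewrite ?expr0 ?mul1r // expr1 mulN1r opprK.
rewrite hD -2!(mulnA (2 ^ sigma)%N) (PoszM (2 ^ sigma)%N) prod_expo.
under eq_bigr do rewrite lE exprMn -exprM mulnC.
have pow2E : (2 ^ sigma)%N%:Z = 2 ^+ sigma by rewrite -natz natrX.
by rewrite big_split /= prodrXr /sign_exp exprD pow2E; ring.
Qed.

Lemma lstar_mod4 l : odd l -> exists a : int, lstar l = 1 + 4 * a.
Proof.
move=> lo; exists (if (l %% 4 == 1)%N then (l %/ 4)%:Z else - (l %/ 4).+1%:Z).
rewrite /lstar; case: ifP; move: lo; clear; lia.
Qed.

Lemma prod_lstar_mod4 : exists a : int,
  \prod_(l <- LL) (lstar l) ^+ (expo ps qs l) = 1 + 4 * a.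
Proof.
move: hodd_prime; elim: (LL) => [|l s IH] /=.
  by move=> _; exists 0; rewrite big_nil; ring.
case/andP=> /andP[_ lo] /IH[b bE]; rewrite big_cons bE.
have [a ->] := lstar_mod4 lo.
elim: (expo _ _ _) => [|n [c cE]]; first by exists b; rewrite mul1r.
exists (a + c + 4 * a * c); rewrite exprS -mulrA cE; ring.
Qed.

Lemma D_mod4 : exists a : int, D = (-1) ^+ sign_exp * 2 ^+ sigma * (1 + 4 * a).
Proof. by have [a aE] := prod_lstar_mod4; exists a; rewrite D_factor aE. Qed.

Lemma sigma_cases : sigma \in [:: 0; 1; 2; 3].
Proof. by move: hsigma; case: sigma => [|[|[|[|]]]]. Qed.

Lemma twist_eq1 :
  (D = 1 %[mod 4])%Z \/ (pow2_exact 2 D /\ ((D %/ 4)%Z = 3 %[mod 4])%Z) ->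
  twist = 1.
Proof.
have [a ->] := D_mod4; rewrite /twist /pow2_exact -(signr_odd L) -signr_odd.
have := sigma_cases; rewrite !inE.
by case/or4P=> /eqP->; case: odd; rewrite ?expr0 ?expr1 ?i2 ?mulrNN ?mulr1 //; lia.
Qed.

Lemma twist_eqN1 :
  (D = 3 %[mod 4])%Z \/ (pow2_exact 2 D /\ ((D %/ 4)%Z = 1 %[mod 4])%Z) ->
  twist = -1.
Proof.
have [a ->] := D_mod4; rewrite /twist /pow2_exact -(signr_odd L) -signr_odd.
have := sigma_cases; rewrite !inE.
by case/or4P=> /eqP->; case: odd; rewrite ?expr0 ?expr1 ?i2 ?mul1r ?mulr1 //; lia.
Qed.

Lemma twist_sqrN1 : pow2_exact 1 D \/ pow2_exact 3 D -> twist ^+ 2 = -1.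
Proof.
have [a ->] := D_mod4; rewrite /twist /pow2_exact exprMn sqrr_sign mul1r.
rewrite -exprM mulnC exprM i2 -(signr_odd _ sign_exp).
have := sigma_cases; rewrite !inE.
by case/or4P=> /eqP->; case: odd; rewrite ?expr0 ?expr1 ?mul1r ?mulr1 //;
  first [lia | by rewrite -signr_odd].
Qed.

Variables (p y : nat).
Hypotheses (p_pr : prime p) (pE : p = (4 * y ^ 2).+1).
Hypothesis pD : ~~ (p%:Z %| 2 * D)%Z.
#[local] Opaque quart.

Lemma quart_D : quart y i (D%:~R : 'F_p) = sym_value ps qs ls psi twist (2 * y).
Proof.
have chiM := quart_mulchar p_pr pE i2; have [_ c1 cM] := chiM.
have -> : D%:~R = (-1) ^+ sign_exp * 2 ^+ sigma *
  \prod_(l <- LL) ((lstar l)%:~R ^+ (expo ps qs l)) :> 'F_p.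
  rewrite D_factor !intrM !rmorphXn /= rmorphN1 rmorph_prod.
  by congr (_ * _); apply: eq_bigr => l _; rewrite rmorphXn.
rewrite !cM (big_morph _ cM c1) !(mulcharX _ _ chiM).
rewrite (quartN1 p_pr pE i2) (quart2 _ i2 p_pr pE) ?pnatr_eq0 //.
rewrite /sym_value; congr (_ * _).
  rewrite /two_part mul2n odd_double doubleK /twist exprMn -!exprM.
  by rewrite ![(_ * y)%N]mulnC.
apply: eq_big_seq => l lLL; rewrite (mulcharX _ _ chiM); congr (_ ^+ _).
have /andP[l_pr lo] := allP hodd_prime l lLL.
have [_ _ _ _ [rec _]] := psiP l_pr lo; apply: rec => //.
apply: contraNneq pD => <-; apply: dvdz_mull.
rewrite D_factor (bigD1_seq l) //=; apply: dvdz_mull; apply: dvdz_mulr.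
apply: dvdz_exp; first by rewrite /expo; case: ifP => //; case: ifP.
by rewrite /lstar; case: ifP; rewrite ?dvdzN ?rpredN ?dvdzz.
Qed.
End SymbolOfD.

(** * Asymptotic equivalence on the Hardy-Littlewood scale *)

Section Asymptotics.
Variable R : realType.

Definition HL_scale (n : nat) : R := Num.sqrt n%:R / ln n%:R.

(** With q the fourth root of n, ln n = 4 ln q < 4 q, so the scale is at least
    q/4. *)
Lemma HL_scale_ge (B : R) : \forall n \near \oo, B <= HL_scale n.
Proof.
have [N NB] : exists N : nat, (4 * B) ^+ 4 <= N%:R.
  exists (Num.truncn ((4 * B) ^+ 4)).+1.
  by rewrite ltW // truncnS_gt.
exists (maxn N 2) => // n /=; rewrite geq_max => /andP[Nn n2].
have n1 : (1 : R) < n%:R by rewrite ltr1n.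
have n0 : (0 : R) < n%:R by apply: lt_trans n1.
have ln0 : 0 < ln (n%:R : R) by rewrite ln_gt0.
pose q : R := Num.sqrt (Num.sqrt n%:R).
have q0 : 0 < q by rewrite !sqrtr_gt0.
have q2 : q ^+ 2 = Num.sqrt n%:R by rewrite sqr_sqrtr ?sqrtr_ge0.
have q4 : q ^+ 4 = n%:R by rewrite (exprM _ 2 2) q2 sqr_sqrtr ?ler0n.
have lnq : ln (n%:R : R) <= 4 * q.
  by rewrite -q4 lnXn // -[ln q *+ 4]mulr_natl ler_pM2l // ltW // ln_sublinear.
rewrite /HL_scale -q2 ler_pdivlMr //.
have [B0|B0] := lerP B 0.
  by apply: le_trans (sqr_ge0 q); rewrite mulr_le0_ge0 // ltW.
have Bq : 4 * B <= q.
  have : (4 * B) ^+ 4 <= q ^+ 4 by rewrite q4 (le_trans NB) // ler_nat.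
  by rewrite ler_pXn2r // nnegrE ?ltW // mulr_gt0.
apply: le_trans (_ : B * (4 * q) <= _); first by rewrite ler_pM2l.
by rewrite mulrA [B * 4]mulrC expr2 ler_pM2r.
Qed.

Lemma equiv_ratio_cvg (f g : nat -> R^o) : f ~_\oo g ->
  (\forall n \near \oo, g n != 0) -> f n / g n @[n --> \oo] --> (1 : R).
Proof.
move=> /eqaddoP fg g0; apply/cvgrPdist_le => e e0.
near=> n.
have gn : g n != 0 by near: n.
have h : `|(f - g) n| <= e * `|g n| by near: n; exact: fg.
have -> : 1 - f n / g n = - ((f n - g n) / g n) by rewrite mulrBl divff // opprB.
by rewrite normrN normrM normfV ler_pdivrMr ?normr_gt0.
Unshelve. all: by end_near. Qed.

Lemma equiv0_eventually (f g : nat -> R^o) : f ~_\oo g ->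
  (forall n, g n = 0) -> \forall n \near \oo, f n = 0.
Proof.
move=> /eqaddoP/(_ 1 ltr01) fg g0; near=> n.
have : `|(f - g) n| <= 1 * `|g n| by near: n.
by rewrite /= g0 normr0 mulr0 normr_le0 /(f - g) /= => /eqP; rewrite fctE g0 subr0.
Unshelve. all: by end_near. Qed.
End Asymptotics.

(** * Primes 1 + x^2 with x in a residue class *)

Section ResidueClasses.
Variables (R : realType) (HL : Hardy_Littlewood_conjecture R).
Variables (M : nat) (M_gt0 : (0 < M)%N) (M_even : ~~ odd M).

Definition class_a : int := M%:Z ^+ 2.
Definition class_b (rho : nat) : int := 2 * M%:Z * rho%:Z.
Definition class_c (rho : nat) : int := rho%:Z ^+ 2 + 1.
Definition in_class (rho p : nat) : bool := prime p &&
  `[< exists x : nat, p%:Z = class_a * x%:Z ^+ 2 + class_b rho * x%:Z + class_c rho >].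
Definition class_count (rho n : nat) : nat :=
  HL_count class_a (class_b rho) (class_c rho) n.

(** The polynomial is (M X + rho)^2 + 1. *)
Lemma class_polyE rho p : (rho < M)%N ->
  (exists x : nat, p%:Z = class_a * x%:Z ^+ 2 + class_b rho * x%:Z + class_c rho)
  <-> (exists2 x : nat, p = (x ^ 2).+1 & (x %% M)%N = rho).
Proof.
move=> rM; have polyE x : class_a * x%:Z ^+ 2 + class_b rho * x%:Z + class_c rho =
    ((M * x + rho) ^ 2).+1%:Z.
  rewrite intS -[((M * x + rho) ^ 2)%N%:Z]/(((M * x + rho)%N ^+ 2)%:Z) rmorphXn /=.
  by rewrite PoszD PoszM /class_a /class_b /class_c; ring.
split=> [[x]|[x -> xr]].
  rewrite polyE => -[->]; exists (M * x + rho)%N => //.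
  by rewrite mulnC modnMDl modn_small.
exists (x %/ M)%N; rewrite polyE; congr (Posz (_ ^ 2).+1).
by rewrite {1}(divn_eq x M) xr mulnC.
Qed.

(** A prime 1 + x^2 belongs to exactly one class, that of its x >= 0. *)
Lemma card_classes (good : pred nat) (S : pred nat) n :
  (forall p, S p <-> prime p /\ exists2 x : nat, p = (x ^ 2).+1 & good (x %% M)%N) ->
  #|[pred p : 'I_n | S p]| = (\sum_(0 <= rho < M | good rho) class_count rho n)%N.
Proof.
move=> SP.
have HLE rho : class_count rho n = (\sum_(p < n) in_class rho p)%N.
  rewrite /class_count /HL_count -sum1_card big_mkcond /=.
  by apply: eq_bigr => p _; rewrite inE -/(in_class rho p); case: in_class.
under eq_bigr do rewrite HLE.
rewrite exchange_big -sum1_card big_mkcond /=; apply: eq_bigr => p _; rewrite inE.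
have -> : (\sum_(0 <= rho < M | good rho) in_class rho p =
  \sum_(0 <= rho < M | good rho) (prime p &&
    `[< exists2 x : nat, p = (x ^ 2).+1 :> nat & (x %% M)%N = rho >]))%N.
  rewrite big_nat_cond [RHS]big_nat_cond; apply: eq_bigr => rho /andP[/andP[_ rM] _].
  by congr (nat_of_bool (_ && _)); apply: asbool_equiv_eq; apply: class_polyE.
case: ifPn => [/SP[p_pr [x px gx]]|nS].
  rewrite big_mkcond (bigD1_seq (x %% M)%N) ?iota_uniq ?mem_index_iota ?ltn_mod //=.
  rewrite gx p_pr asboolT; last by exists x.
  rewrite big1 // => rho rx /=; rewrite asboolF ?if_same // => -[x' px' xr].
  move: px'; rewrite px => -[/eqP]; rewrite eqn_exp2r // => /eqP xx.
  by move: rx; rewrite -xr xx eqxx.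
rewrite big1 // => rho grho; case: (boolP (prime p)) => //= p_pr.
rewrite asboolF // => -[x px xr]; case/negP: nS; apply/SP; split=> //.
by exists x => //; rewrite xr.
Qed.

(** The discriminant is -4 M^2, the leading coefficient is M^2 and every prime
    dividing M^2 divides the middle coefficient, whatever rho is. *)
Lemma class_deltaE rho : HL_delta R class_a (class_b rho) (class_c rho) =
  HL_delta R class_a 0 1.
Proof.
rewrite /HL_delta; congr (_ / _ * _ * _).
- congr (_%:~R); rewrite addr0.
  have h (z : int) : (2 %| z)%Z -> gcdz 2 z = 2.
    by move=> d2; rewrite /gcdz (gcdn_idPl d2).
  have d2M : (2 %| M%:Z)%Z by rewrite dvdzE /= dvdn2.
  have d2a : (2 %| class_a)%Z by apply: dvdz_exp.
  by rewrite !h // rpredD // /class_b -mulrA dvdz_mulr.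
- rewrite big_seq_cond [RHS]big_seq_cond; apply: eq_bigl => q.
  case: (boolP (q \in primes _)) => //=; rewrite dvdz0 mem_primes => /and3P[q_pr _].
  rewrite Euclid_dvdM // orbb andbT => qM.
  by rewrite /class_b dvdz_mulr ?andbT // dvdz_mull // dvdzE.
- congr (limn _); rewrite funeqE => n; rewrite /HL_partial_prod.
  have -> : discr class_a (class_b rho) (class_c rho) = discr class_a 0 1.
    by rewrite /discr /class_a /class_b /class_c; ring.
  by [].
Qed.

Lemma class_HL rho : coprime M (rho ^ 2 + 1) ->
  (fun n : nat => (class_count rho n)%:R : R^o) ~_\oo
  (fun n : nat => HL_delta R class_a 0 1 * HL_scale R n).
Proof.
move=> co; rewrite -(class_deltaE rho); apply: HL.
- by rewrite /class_a exprn_gt0.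
- have cE : class_c rho = (rho ^ 2 + 1)%N%:Z.
    by rewrite /class_c PoszD; congr (_ + _); rewrite -natz natrX natz.
  have /eqP cz : coprimez class_a (class_c rho).
    by rewrite cE /class_a coprimez_pexpl.
  apply/eqP; rewrite -/(coprimez _ _) /coprimez -gcdzA.
  by rewrite [gcdz (class_b _) _]gcdzC gcdzA cz /gcdz gcd1n.
- case=> _ c2; have: (2 %| gcdn M (rho ^ 2 + 1))%N.
    rewrite dvdn_gcd; apply/andP; split; first by rewrite dvdn2.
    by move: c2; rewrite /class_c; clear; lia.
  by move: co; rewrite /coprime => /eqP->.
- case=> k; rewrite /discr /class_a /class_b /class_c => e.
  have : (k ^+ 2 : int) < 0.
    rewrite -e (_ : _ - _ = - (4 * M%:Z ^+ 2)); last by ring.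
    by rewrite oppr_lt0 mulr_gt0 // exprn_gt0.
  by rewrite ltNge sqr_ge0.
Qed.
End ResidueClasses.

(** * Equidistribution among residue classes *)

Lemma card_ord_lt n b : (#|[pred p : 'I_n | (p < b)%N]| <= b)%N.
Proof.
rewrite -sum1_card big_mkcond /=.
rewrite (eq_bigr (fun p : 'I_n => (p < b : nat)%N)); last first.
  by move=> p _; rewrite inE; case: ltnP.
suff -> : (\sum_(p < n) (p < b) = minn n b)%N by exact: geq_minr.
elim: n => [|n IH]; first by rewrite big_ord0 min0n.
by rewrite big_ord_recr IH /=; clear; lia.
Qed.

Section Density.
Variables (R : realType) (HL : Hardy_Littlewood_conjecture R).

(** A zero constant would force the count to vanish eventually. *)
Lemma equiv_scale_neq0 (f : nat -> nat) (d : R) n0 :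
  (forall n, (n0 <= n)%N -> (0 < f n)%N) ->
  (fun n => (f n)%:R : R^o) ~_\oo (fun n => d * HL_scale R n) -> d != 0.
Proof.
move=> f_gt0 fd; apply/eqP => d0.
have g0 n : d * HL_scale R n = 0 by rewrite d0 mul0r.
have [N _ NP] := equiv0_eventually fd g0.
have := NP (maxn N n0) (leq_maxl _ _).
by move/eqP; rewrite pnatr_eq0 eqn0Ngt f_gt0 // leq_maxr.
Qed.

(** From the conjecture for X^2 + 1, whose constant is nonzero because 2 = 1 + 1
    is prime. *)
Lemma large_prime B : exists p x : nat, [/\ prime p, p = (x ^ 2).+1 & (B < p)%N].
Proof.
have hl : (fun n : nat => (HL_count 1 0 1 n)%:R : R^o) ~_\oo
   (fun n : nat => HL_delta R 1 0 1 * HL_scale R n).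
  apply: HL => //.
  - by case.
  - by case=> k; rewrite /discr => e; have := sqr_ge0 k; rewrite -e.
have d0 : HL_delta R 1 0 1 != 0.
  apply: (@equiv_scale_neq0 _ _ 3 _ hl) => n n3.
  apply/card_gt0P; exists (Ordinal n3); rewrite inE /=.
  by exists 1%N.
set d := HL_delta R 1 0 1 in hl d0.
have d_gt0 : 0 < `|d| by rewrite normr_gt0.
move/eqaddoP: hl => /(_ (1 / 2)) hl.
have [N1 _ h1] := hl ltac:(by rewrite divr_gt0).
have [N2 _ h2] := @HL_scale_ge R (2 * B.+2%:R / `|d|).
pose n := maxn N1 N2.
have {h1} h1 := h1 n (leq_maxl _ _); have {h2} h2 := h2 n (leq_maxr _ _).
have cnt : (B.+1 < HL_count 1 0 1 n)%N.
  rewrite -(ltr_nat R); move: h1 => /=.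
  set c := (HL_count 1 0 1 n)%:R; set s := HL_scale R n in h2 *.
  have s_ge0 : 0 <= s by apply: le_trans h2; rewrite divr_ge0 ?mulr_ge0.
  rewrite -[((_ : nat -> R^o) - _) n]/(c - d * s) => h1.
  have ds : `|d * s| >= 2 * B.+2%:R.
    by rewrite normrM (ger0_norm s_ge0) [`|d| * s]mulrC -ler_pdivrMr.
  have : `|d * s| - `|c| <= `|c - d * s|.
    by rewrite distrC; apply: lerB_dist.
  rewrite (ger0_norm (ler0n _ _)) => h3.
  have : B.+2%:R <= c by lra.
  by apply: lt_le_trans; rewrite ltr_nat.
apply: contrapT => no.
have : (HL_count 1 0 1 n <= B.+1)%N.
  rewrite /HL_count; apply: leq_trans (card_ord_lt n B.+1).
  apply: subset_leq_card; apply/fintype.subsetP => q; rewrite !inE /= ltnS.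
  case/andP=> q_pr /asboolP[x qx]; rewrite leqNgt; apply/negP => Bq.
  apply: no; exists (q : nat), x; split=> //.
  by move: qx; rewrite !mul1r mul0r addr0; clear; lia.
by rewrite leqNgt cnt.
Qed.

Section Limit.
Variables (M : nat) (M_gt0 : (0 < M)%N) (M_even : ~~ odd M).
Local Notation delta := (HL_delta R (class_a M) 0 1).

(** A prime 1 + x^2 exceeding M lies in an admissible class, whose count is then
    positive; the constant is the same for all admissible classes. *)
Lemma class_delta_neq0 : delta != 0.
Proof.
have [p [x [p_pr px Mp]]] := large_prime M.
have co : coprime M ((x %% M) ^ 2 + 1).
  have pc : coprime M p.
    by rewrite coprime_sym prime_coprime // gtnNdvd.
  rewrite -coprime_modr -modnDml modnXm modnDml coprime_modr addn1 -px //.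
apply: (equiv_scale_neq0 (n0 := p.+1) _ (class_HL HL M_gt0 M_even co)) => n pn.
rewrite /class_count /HL_count; apply/card_gt0P; exists (Ordinal pn).
rewrite inE /= p_pr /=.
have rM : (x %% M < M)%N by rewrite ltn_mod.
by apply/asboolP/(class_polyE _ rM); exists x.
Qed.

Lemma delta_scale_neq0 : \forall n \near \oo, delta * HL_scale R n != 0.
Proof.
have := @HL_scale_ge R 1; apply: filterS => n h.
by rewrite mulf_neq0 ?class_delta_neq0 // gt_eqF // (lt_le_trans ltr01 h).
Qed.

Lemma class_sum_cvg (good : pred nat) :
  (forall c, good c -> coprime M (c ^ 2 + 1)) ->
  (\sum_(0 <= rho < M | good rho) class_count M rho n)%N%:R / (delta * HL_scale R n)
    @[n --> \oo] --> ((\sum_(0 <= rho < M) good rho)%N%:R : R).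
Proof.
move=> goodP.
elim: (index_iota 0 M) => [|rho s IH].
  rewrite !big_nil; under eq_fun do rewrite big_nil mul0r; exact: cvg_cst.
have [g|/negbTE ng] := boolP (good rho); rewrite big_cons.
  rewrite g natrD; under eq_fun do rewrite big_cons g natrD mulrDl.
  apply: cvgD => //.
  exact: equiv_ratio_cvg (class_HL HL M_gt0 M_even (goodP _ g)) delta_scale_neq0.
by rewrite ng add0n; under eq_fun do rewrite big_cons ng.
Qed.

(** Divide numerator and denominator by the common scale.  The primes in the
    classes that are not admissible divide M, so they contribute a bounded
    number. *)
Lemma density_limit (good : pred nat) (S P : pred nat) :
  (forall c, good c -> coprime M (c ^ 2 + 1)) ->
  (forall p, S p <-> prime p /\ exists2 x : nat, p = (x ^ 2).+1 & good (x %% M)%N) ->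
  (forall p, P p <-> prime p /\ exists x : nat, p = (x ^ 2).+1) ->
  #|[pred p : 'I_n.+1 | S p]|%:R / #|[pred p : 'I_n.+1 | P p]|%:R @[n --> \oo] -->
  ((\sum_(0 <= rho < M) good rho)%N%:R /
  (\sum_(0 <= rho < M) coprime M (rho ^ 2 + 1))%N%:R : R).
Proof.
move=> goodP SP PP.
pose adm c := coprime M (c ^ 2 + 1).
pose h n : R := delta * HL_scale R n.
pose E n := #|[pred p : 'I_n | P p && (p %| M)%N]|.
pose num n := #|[pred p : 'I_n | S p]|.
pose den n := #|[pred p : 'I_n | P p]|.
have num_cvg : (num n)%:R / h n @[n --> \oo] --> ((\sum_(0 <= rho < M) good rho)%N%:R : R).
  under eq_fun do rewrite /num (card_classes M_gt0 _ SP).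
  exact: class_sum_cvg.
have coP x : coprime M ((x %% M) ^ 2 + 1) = coprime M (x ^ 2 + 1).
  by rewrite -coprime_modr -modnDml modnXm modnDml coprime_modr.
have denE n : den n = (\sum_(0 <= rho < M | adm rho) class_count M rho n + E n)%N.
  rewrite -(card_classes (S := fun p => P p && ~~ (p %| M)%N) M_gt0); last first.
    move=> p; split.
      move=> /andP[/PP[p_pr [x px]] pM]; split=> //; exists x => //.
      by rewrite /adm coP addn1 -px coprime_sym prime_coprime.
    move=> [p_pr [x px]]; rewrite /adm coP addn1 -px coprime_sym prime_coprime // => pM.
    by apply/andP; split=> //; apply/PP; split=> //; exists x.
  have cE (T : pred nat) : #|[pred p : 'I_n | T p]| = (\sum_(p < n) T p)%N.
    by rewrite -sum1_card big_mkcond; apply: eq_bigr => p _; rewrite inE; case: (T p).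
  rewrite /den /E (cE P) (cE (fun p => P p && ~~ (p %| M)%N)).
  rewrite (cE (fun p => P p && (p %| M)%N)) -big_split; apply: eq_bigr => p _ /=.
  by case: (P p) => //=; case: (_ %| _)%N.
have E_cvg : (E n)%:R / h n @[n --> \oo] --> (0 : R).
  apply/cvgrPdist_le => e e0.
  have d_gt0 : 0 < `|delta| by rewrite normr_gt0 class_delta_neq0.
  have := @HL_scale_ge R (M.+1%:R / (e * `|delta|)); apply: filterS => n hn.
  have s_ge0 : 0 <= HL_scale R n by apply: le_trans hn; rewrite divr_ge0 // mulr_ge0 // ltW.
  rewrite sub0r normrN normrM normfV (ger0_norm (ler0n _ _)).
  have EM : (E n <= M.+1)%N.
    apply: leq_trans (card_ord_lt n M.+1); apply: subset_leq_card.
    by apply/fintype.subsetP => q; rewrite !inE ltnS => /andP[_ /dvdn_leq->].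
  have hn0 : M.+1%:R <= e * `|h n|.
    rewrite /h normrM (ger0_norm s_ge0) mulrA mulrC -ler_pdivrMr // mulr_gt0 //.
  have h_gt0 : 0 < `|h n|.
    by rewrite -(pmulr_rgt0 _ e0); apply: lt_le_trans hn0; rewrite ltr0n.
  by rewrite ler_pdivrMr // (le_trans _ hn0) // ler_nat.
have adm_cvg := class_sum_cvg (good := adm) (fun c => id).
have den_cvg : (den n)%:R / h n @[n --> \oo] --> ((\sum_(0 <= rho < M) adm rho)%N%:R : R).
  rewrite -[X in _ --> X]addr0.
  under eq_fun do rewrite denE natrD mulrDl.
  exact: cvgD.
have A0 : (\sum_(0 <= rho < M) adm rho)%N%:R != 0 :> R.
  rewrite pnatr_eq0 -lt0n (bigD1_seq 0%N) ?iota_uniq ?mem_index_iota //=.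
  by rewrite /adm coprimen1.
have ratio_cvg : (num n)%:R / h n * ((den n)%:R / h n)^-1 @[n --> \oo] -->
    ((\sum_(0 <= rho < M) good rho)%N%:R / (\sum_(0 <= rho < M) adm rho)%N%:R : R).
  by apply: cvgM num_cvg _; exact: cvgV.
have ratio2 : (num n)%:R / (den n)%:R @[n --> \oo] -->
    ((\sum_(0 <= rho < M) good rho)%N%:R / (\sum_(0 <= rho < M) adm rho)%N%:R : R).
  apply: cvg_trans ratio_cvg; apply: near_eq_cvg.
  have := delta_scale_neq0; apply: filterS => n hn0 /=.
  by rewrite invf_div mulrA divfK.
by rewrite -(cvg_shiftS (fun n => (num n)%:R / (den n)%:R : R)) in ratio2.
Qed.
End Limit.

End Density.

(** * Assembling the densities *)

Lemma prime_dvd_prod p (s : seq nat) : prime p -> all prime s ->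
  (p %| \prod_(l <- s) l)%N = (p \in s).
Proof.
move=> p_pr; elim: s => [|l s IH] /=.
  by rewrite big_nil dvdn1 eqn_leq leqNgt prime_gt1.
by case/andP=> l_pr sp; rewrite big_cons Euclid_dvdM // dvdn_prime2 // IH // inE.
Qed.

Lemma tau_prod (s : seq nat) : uniq s -> all prime s ->
  tau (prod_seq s) = prod_tau s.
Proof.
move=> us sp; rewrite /tau /prod_tau; apply: perm_big; apply: uniq_perm => //.
  exact: primes_uniq.
move=> p; rewrite mem_primes /prod_seq.
have -> : (0 < \prod_(l <- s) l)%N.
  by rewrite big_seq prodn_cond_gt0 // => l /(allP sp)/prime_gt0.
apply/idP/idP => [/andP[p_pr]|ps]; first by rewrite prime_dvd_prod.
by rewrite (allP sp _ ps) /= prime_dvd_prod // (allP sp).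
Qed.

Lemma prod_tau_cat s1 s2 : prod_tau (s1 ++ s2) = (prod_tau s1 * prod_tau s2)%N.
Proof. by rewrite /prod_tau big_cat. Qed.

Lemma prod_tau_gt0 s : all (fun p => prime p && odd p) s -> (0 < prod_tau s)%N.
Proof.
move=> /allP sp; rewrite /prod_tau big_seq prodn_cond_gt0 // => l /sp/andP[l_pr l_odd].
rewrite /tau_prime; case: ifP => _; first exact: prime_gt0.
by move: l_odd (prime_gt1 l_pr); clear; lia.
Qed.

Lemma exists_local_symbols : exists psi : nat -> nat -> algC,
  forall l, prime l -> odd l -> local_symbol 'i l (psi l).
Proof.
have two_C : (2 : algC) != 0 by rewrite pnatr_eq0.
have i2 : 'i ^+ 2 = -1 :> algC by rewrite sqrCi.
suff h l : exists f : nat -> algC, prime l -> odd l -> local_symbol 'i l f.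
  by have [psi psiP] := boolp.choice h; exists psi.
case: (boolP (prime l && odd l)) => [/andP[l_pr lo]|nl].
  by have [f fP] := local_symbol_exists two_C i2 l_pr lo; exists f.
by exists (fun=> 0) => l_pr lo; rewrite l_pr lo in nl.
Qed.

Section Main.
Variables (R : realType) (HL : Hardy_Littlewood_conjecture R).
Variables (neg : bool) (sigma : nat) (ps qs ls : seq nat) (D : int).
Local Notation LL := (ps ++ qs ++ ls).
Hypothesis hodd_prime : all (fun p => prime p && odd p) LL.
Hypothesis hdistinct : uniq LL.
Hypothesis hD : D = (-1) ^+ neg *
      (2 ^ sigma * prod_seq ps * prod_seq qs ^ 2 * prod_seq ls ^ 3)%N%:Z.
Variables (C : numFieldType) (i : C) (psi : nat -> nat -> C).
Hypothesis i2 : i ^+ 2 = -1.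
Hypothesis psiP : forall l, prime l -> odd l -> local_symbol i l (psi l).

Local Notation tw := (twist i neg sigma ps qs ls).
Local Notation v := (sym_value ps qs ls psi tw).
Local Notation M := (modulus ps qs ls).

Lemma dvd_2D_modulus p : prime p -> (p%:Z %| 2 * D)%Z -> (p %| M)%N.
Proof.
move=> p_pr; rewrite dvdzE hD !abszM abszX /= exp1n mul1n /modulus.
have LL_pr : all prime LL by apply: sub_all hodd_prime => l /andP[].
have := LL_pr; rewrite !all_cat => /and3P[psP qsP lsP].
have d8 : (p %| 2)%N -> (p %| 8)%N by move/dvdn_trans; apply.
rewrite !Euclid_dvdM // !Euclid_dvdX // !prime_dvd_prod // !mem_cat.
rewrite -[(1 + 1)%N]/2%N; case: (boolP (p %| 2)%N) d8 => [_ ->//|_ _].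
by case: (p \in ps); case: (p \in qs); case: (p \in ls); rewrite ?orbT.
Qed.

Lemma square_int_nat (m : int) p : m ^+ 2 = 1 ->
  (exists x : int, p%:Z = m ^+ 2 + x ^+ 2) <-> exists x : nat, p = (x ^ 2).+1.
Proof.
move=> ->; split=> [[x px]|[x ->]].
  exists `|x|%N; apply/eqP; rewrite -eqz_nat px intS.
  by rewrite -[(`|x| ^ 2)%N%:Z]natz natrX natz abszE real_normK ?num_real.
by exists x%:Z; rewrite intS; congr (_ + _); rewrite -natz natrX natz.
Qed.

(** A prime dividing 2 D divides M, and the symbol vanishes on its class; at the
    other primes the trace is read off from the symbol. *)
Lemma frob_trace_class (e : bool) (p : nat) :
  [&& prime p && `[< exists x : int, p%:Z = ((-1) ^+ e) ^+ 2 + x ^+ 2 >],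
      ~~ (p%:Z %| 2 * D)%Z & frob_trace D p == 2 * (-1) ^+ e] <->
  prime p /\ exists2 x : nat, p = (x ^ 2).+1 & v (x %% M)%N == (-1) ^+ e.
Proof.
have tw4 := twist4 i2 neg sigma ps qs ls.
have per := sym_value_period hodd_prime hdistinct psiP tw4.
have unit := sym_value_unit hodd_prime hdistinct psiP tw4.
have key x : p = (x ^ 2).+1 -> prime p -> ~~ (p%:Z %| 2 * D)%Z -> ~~ odd x ->
    (frob_trace D p == 2 * (-1) ^+ e) = (v x == (-1) ^+ e).
  move=> px p_pr pD x_even.
  have xE : x = (2 * x./2)%N by rewrite mul2n even_halfK.
  have pE : p = (4 * x./2 ^ 2).+1 by rewrite px {1}xE expnMn.
  rewrite (frob_trace_pm2 p_pr pE i2); last first.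
    rewrite -(dvdz_pcharf (pchar_Fp p_pr)).
    by apply: contraNN pD => pD; rewrite dvdz_mull.
  by rewrite {2}xE (quart_D i2 hodd_prime hdistinct psiP hD p_pr pE pD).
split.
  case/and3P=> /andP[p_pr /asboolP px] pD fr; split=> //.
  have [x {}px] := (square_int_nat p (sqrr_sign _ e)).1 px.
  exists x => //; rewrite per -(key x) //.
  apply/negP => x_odd; case/negP: pD; apply: dvdz_mulr.
  have : ~~ odd p by rewrite px /= oddX x_odd.
  by rewrite -dvdn2 dvdn_prime2 // => /eqP<-.
move=> [p_pr [x px]]; rewrite per => vx.
have vx0 : v x != 0 by rewrite (eqP vx) signr_eq0.
have co : coprime M p.
  move: (unit x); case: ifP => [co _|_ v0]; last by rewrite v0 eqxx in vx0.
  by rewrite px -addn1.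
have x_even : ~~ odd x.
  by apply: contraNN vx0 => ox; rewrite /sym_value /two_part ox mul0r.
have pD : ~~ (p%:Z %| 2 * D)%Z.
  apply/negP => /(dvd_2D_modulus p_pr).
  by move: co; rewrite coprime_sym prime_coprime // => /negP.
apply/and3P; split=> //; last by rewrite (key x).
rewrite p_pr; apply/asboolP; apply: (square_int_nat p (sqrr_sign _ e)).2.
by exists x.
Qed.

Lemma sign_sqr_exists e p :
  (prime p && `[< exists x : int, p%:Z = ((-1) ^+ e) ^+ 2 + x ^+ 2 >]) <->
  prime p /\ exists x : nat, p = (x ^ 2).+1.
Proof.
split=> [/andP[p_pr /asboolP px]|[p_pr px]].
  by split=> //; apply: (square_int_nat p (sqrr_sign _ e)).1.
by rewrite p_pr; apply/asboolP; apply: (square_int_nat p (sqrr_sign _ e)).2.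
Qed.

Local Notation r := (size ps).
Local Notation t := (size ls).

Lemma dens_cvg (e : bool) :
  dens_seq R D ((-1) ^+ e) @ \oo -->
  (1 / 4 * (1 + (if tw ^+ 2 == 1 then
      (-1) ^+ (r + t) / (tau (prod_seq ps * prod_seq ls))%:R else 0)
    + (-1) ^+ e * (if tw == 1 then
        2 * (-1) ^+ (count_mod8 1 ps + count_mod8 7 ps + size qs
                     + count_mod8 1 ls + count_mod8 7 ls)
        / (tau (prod_seq ps * prod_seq qs * prod_seq ls))%:R else 0)) : R).
Proof.
have tw4 := twist4 i2 neg sigma ps qs ls.
have unit := sym_value_unit hodd_prime hdistinct psiP tw4.
have M_gt0 := modulus_gt0 hodd_prime.
have M_even : ~~ odd M by rewrite /modulus oddM.
have goodP c : v c == (-1) ^+ e -> coprime M (c ^ 2 + 1).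
  move: (unit c); case: ifP => // _ -> /eqP/esym/eqP.
  by rewrite signr_eq0.
have lim := density_limit HL M_gt0 M_even (good := fun c => v c == (-1) ^+ e)
  goodP (frob_trace_class e) (sign_sqr_exists e).
have cE := sym_countE i2 hodd_prime hdistinct psiP tw4 e.
have uE := unit_countE hodd_prime hdistinct psiP tw4.
have allP s : subseq s LL -> uniq s /\ all prime s.
  move=> sL; split; first exact: subseq_uniq sL hdistinct.
  apply/seq.allP => l ls'; have := mem_subseq sL ls'.
  by move=> /(seq.allP hodd_prime)/andP[].
have sub1 : subseq (ps ++ ls) LL by rewrite cat_subseq ?suffix_subseq.
have [u1 p1] := allP _ sub1.
have [u2 p2] := allP _ (subseq_refl LL).
have t1 : tau (prod_seq ps * prod_seq ls) = (prod_tau ps * prod_tau ls)%N.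
  by rewrite -prod_tau_cat -tau_prod // /prod_seq big_cat.
have t2 : tau (prod_seq ps * prod_seq qs * prod_seq ls) = prod_tau LL.
  by rewrite -tau_prod // /prod_seq !big_cat /= mulnA.
have pL := prod_tau_gt0 hodd_prime.
have pLE : prod_tau LL = (prod_tau ps * prod_tau ls * prod_tau qs)%N.
  by rewrite !prod_tau_cat mulnAC mulnA.
rewrite t1 t2.
set L := (X in _ --> X).
have <- : (\sum_(0 <= rho < M) (v rho == (-1) ^+ e))%N%:R /
    (\sum_(0 <= rho < M) coprime M (rho ^ 2 + 1))%N%:R = L :> R.
  rewrite -/(unit_count ps qs ls) uE -/(sym_count ps qs ls psi tw ((-1) ^+ e)).
  rewrite [X in X / _]pmulrn cE /L natrM pLE !natrM.
  have [h1 [h2 h3]] : (prod_tau ps)%:R != 0 :> R /\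
      (prod_tau ls)%:R != 0 :> R /\ (prod_tau qs)%:R != 0 :> R.
    by move: pL; rewrite pLE !muln_gt0 !lt0n !pnatr_eq0 => /andP[/andP[-> ->] ->].
  have sgnE : (count_pm1_mod8 ps + size qs + count_pm1_mod8 ls)%N =
      (count_mod8 1 ps + count_mod8 7 ps + size qs
      + count_mod8 1 ls + count_mod8 7 ls)%N by rewrite /count_pm1_mod8 !addnA.
  rewrite sgnE.
  set w : nat := (_ + _ + _ + _ + _)%N.
  case: ifP => _; case: ifP => _;
    rewrite ?(intrD, intrM, rmorphXn) /= ?rmorphN1 -?pmulrn natrM; field;
    by rewrite h1 h2 h3.
exact: lim.
Qed.
End Main.

Theorem corollary3p10 (R : realType) (HL : Hardy_Littlewood_conjecture R)
    (neg : bool) (sigma : nat) (ps qs ls : seq nat) (D : int)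
    (hsigma : (sigma <= 3)%N)
    (hodd_prime : all (fun p => prime p && odd p) (ps ++ qs ++ ls))
    (hdistinct : uniq (ps ++ qs ++ ls))
    (hD : D = (-1) ^+ neg *
      (2 ^ sigma * prod_seq ps * prod_seq qs ^ 2 * prod_seq ls ^ 3)%N%:Z) :
  let r := size ps in
  let s := size qs in
  let t := size ls in
  let u : R := (-1) ^+ (r + t) / (tau (prod_seq ps * prod_seq ls))%:R in
  let v : R := 2 * (-1) ^+ (count_mod8 1 ps + count_mod8 7 ps + s
                            + count_mod8 1 ls + count_mod8 7 ls)
               / (tau (prod_seq ps * prod_seq qs * prod_seq ls))%:R in
  [/\ (D = 1 %[mod 4])%Z \/
        (pow2_exact 2 D /\ ((D %/ 4)%Z = 3 %[mod 4])%Z) ->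
        dens_seq R D 1 @ \oo --> 1 / 4 * (1 + u + v) /\
        dens_seq R D (-1) @ \oo --> 1 / 4 * (1 + u - v),
      (D = 3 %[mod 4])%Z \/
        (pow2_exact 2 D /\ ((D %/ 4)%Z = 1 %[mod 4])%Z) ->
        dens_seq R D 1 @ \oo --> 1 / 4 * (1 + u) /\
        dens_seq R D (-1) @ \oo --> 1 / 4 * (1 + u)
    & pow2_exact 1 D \/ pow2_exact 3 D ->
        dens_seq R D 1 @ \oo --> (1 / 4 : R) /\
        dens_seq R D (-1) @ \oo --> (1 / 4 : R)].
Proof.
move=> r s t u v.
have i2 : 'i ^+ 2 = -1 :> algC by rewrite sqrCi.
have N1 : (1 : algC) != -1 by rewrite one_neqN1 ?pnatr_eq0.
have [psi psiP] := exists_local_symbols.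
have lim := dens_cvg HL hodd_prime hdistinct hD i2 psiP.
pose tw : algC := twist 'i neg sigma ps qs ls.
have limP : dens_seq R D 1 @ \oo --> (1 / 4 * (1 +
    (if tw ^+ 2 == 1 then u else 0) +
    (if tw == 1 then v else 0)) : R).
  by have := lim false; rewrite !expr0 [1 * (if _ then _ else _)]mul1r.
have limN : dens_seq R D (-1) @ \oo --> (1 / 4 * (1 +
    (if tw ^+ 2 == 1 then u else 0) -
    (if tw == 1 then v else 0)) : R).
  by have := lim true; rewrite !expr1 [-1 * (if _ then _ else _)]mulN1r.
split => h.
- have twE : tw = 1 := twist_eq1 i2 hsigma hodd_prime hdistinct hD h.
  by move: limP limN; rewrite twE expr1n eqxx.
- have twE : tw = -1 := twist_eqN1 i2 hsigma hodd_prime hdistinct hD h.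
  move: limP limN; rewrite twE sqrrN expr1n eqxx eq_sym (negbTE N1).
  by rewrite subr0 addr0.
- have twE : tw ^+ 2 = -1 := twist_sqrN1 i2 hsigma hodd_prime hdistinct hD h.
  move: limP limN; rewrite twE eq_sym (negbTE N1).
  have /negbTE-> : tw != 1.
    by apply: contra_eq_neq twE => ->; rewrite expr1n.
  by rewrite subr0 !addr0 mulr1.
Qed.
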